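(* Let $(\zeta_t)_{t\ge0}$ be the colored TASEP on $\mathbb Z$ with $\zeta_0(i)=i$, and for $i\in\mathbb Z$, $t\ge 0$, $y\in\mathbb Z+\tfrac12$ let $$\mathcal H^{\geqslant i}_{\mathrm{TASEP}}(t,y)=\#\{x\in\mathbb Z : x<y \text{ and } \zeta_t(x)\ge i\}.$$ Choose $n\ge 1$, an index $\iota\ge 1$, color cutoff levels $k_1,\dots,k_n\in\mathbb Z$, a time $t\ge 0$, and observation points $y_1,\dots,y_n\in\mathbb Z+\tfrac12$. For $j=1,\dots,n$ set $$k_j'=\begin{cases}k_j,& j\neq\iota,\\ k_\iota+1,& j=\iota,\end{cases}\qquad\qquad y_j'=\begin{cases}y_j,& j\ne\iota,\\ y_\iota+1,& j=\iota.\end{cases}$$ Assume that $$k_1\le k_2\le\dots\le k_n,\qquad k_1'\le k_2'\le\dots\le k_n',$$ $$y_1\ge y_2\ge\dots\ge y_n,\qquad y_1'\ge y_2'\ge\dots\ge y_n'.$$ Then the random vectors $$\bigl(\mathcal H^{\geqslant k_1}_{\mathrm{TASEP}}(t,y_1),\,\mathcal H^{\geqslant k_2}_{\mathrm{TASEP}}(t,y_2),\,\dots,\,\mathcal H^{\geqslant k_n}_{\mathrm{TASEP}}(t,y_n)\bigr)$$ and $$\bigl(\mathcal H^{\geqslant k_1'}_{\mathrm{TASEP}}(t,y_1'),\,\mathcal H^{\geqslant k_2'}_{\mathrm{TASEP}}(t,y_2'),\,\dots,\,\mathcal H^{\geqslant k_n'}_{\mathrm{TASEP}}(t,y_n')\bigr)$$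 have the same distribution.
   Context: Colored (multi-species) TASEP on $\mathbb Z$: it is a time-dependent assignment $\zeta_t$, $t\ge0$, of integer labels (colors) to the points of $\mathbb Z$, with $\zeta_0(i)=i$ for all $i\in\mathbb Z$. Each edge $(k,k+1)$, $k\in\mathbb Z$, carries an independent rate $1$ Poisson process (exponential clock). Whenever the clock of edge $(k,k+1)$ rings at time $t$, check whether $\zeta_{t-}(k+1)<\zeta_{t-}(k)$. If so, nothing happens; otherwise the colors at $k$ and $k+1$ are swapped: $\zeta_{t+}(k+1)=\zeta_{t-}(k)$ and $\zeta_{t+}(k)=\zeta_{t-}(k+1)$. The process is well defined almost surely via the standard graphical (Harris) representation. *)

(* Defs.v *)
From HB Require Import structures.
From mathcomp Require Import all_boot all_order all_algebra finmap.
From mathcomp Require Import all_classical all_reals all_analysis measurable_realfun.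

Set Implicit Arguments.
Unset Strict Implicit.
Unset Printing Implicit Defensive.

Import Order.TTheory GRing.Theory Num.Theory.
Import numFieldNormedType.Exports.

Local Open Scope classical_set_scope.
Local Open Scope ring_scope.

Section Independence.
Context (d : measure_display) (T : measurableType d) (R : realType).
Variable P : probability T R.

(* Mutual independence of a family of classes of events: the product rule
   holds over every finite subfamily. *)
Definition independent_classes (I : choiceType) (F : I -> set (set T)) : Prop :=
  forall (J : {fset I}) (E : I -> set T),
    (forall i, i \in J -> F i (E i)) ->
    P (\bigcap_(i in [set` J]) E i) = (\prod_(i <- J) P (E i))%E.

Definition independent_RVs (I : choiceType) (d' : measure_display)
    (T' : measurableType d') (X : I -> T -> T') : Prop :=
  independent_classes (fun i => preimage_set_system setT (X i) measurable).

Definition same_distribution (d' : measure_display) (T' : measurableType d')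
    (X Y : T -> T') : Prop :=
  forall B : set T', measurable B -> pushforward P X B = pushforward P Y B.

End Independence.

Section PoissonClocks.
Context (d : measure_display) (T : measurableType d) (R : realType).
Variable P : probability T R.

(* Counting process of a rate [1] Poisson process on [0, +oo[; its values at
   negative times are irrelevant. *)
Record poisson_process (N : R -> T -> nat) : Prop := {
  poisson_process_measurable :
    forall t, 0 <= t -> measurable_fun setT (N t);
  poisson_process0 : forall w, N 0 w = 0%N;
  poisson_process_nondecreasing :
    forall w s t, 0 <= s -> s <= t -> (N s w <= N t w)%N;
  poisson_process_right_continuous :
    forall w t, 0 <= t -> \forall s \near t^'+, N s w = N t w;
  poisson_process_independent_increments :
    forall t : nat -> R, 0 <= t 0%N -> (forall m, t m <= t m.+1) ->
      independent_RVs P (fun (m : nat) w => (N (t m.+1) w - N (t m) w)%N);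
  poisson_process_increment_law :
    forall s t m, 0 <= s -> s < t ->
      P [set w | (N t w - N s w)%N = m] = (poisson_pmf (t - s) m)%:E }.

Definition process_sigma_algebra (N : R -> T -> nat) : set (set T) :=
  <<s \bigcup_(t in [set t | 0 <= t])
        preimage_set_system setT (N t) measurable >>.

(* [N k] counts the rings of the clock of the edge (k, k + 1). *)
Definition poisson_clocks (N : int -> R -> T -> nat) : Prop :=
  (forall k, poisson_process (N k)) /\
  independent_classes P (fun k => process_sigma_algebra (N k)).

End PoissonClocks.

Definition rings (R : realType) (N : R -> nat) (t : R) : Prop :=
  0 < t /\ forall s, 0 <= s -> s < t -> (N s < N t)%N.

(* A trajectory [z] (the color of the site [x] at time [t] is [z t x]) which
   starts from the identity and follows the swap rule when [ring k t] means
   that the clock of the edge (k, k + 1) rings at time [t]. Trajectories are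
   right-continuous, so [z t] is the state just after [t], and [zm] is the state
   just before [t]; limits are sitewise and, colors being integers, amount to
   being eventually constant. The swap rules of two adjacent edges may conflict if
   their clocks ring simultaneously, which has probability 0. *)
Definition colored_TASEP_path (R : realType) (ring : int -> R -> Prop)
    (z : R -> int -> int) : Prop :=
  [/\ forall x, z 0 x = x,
      forall t x, 0 <= t -> \forall s \near t^'+, z s x = z t x
    & forall t, 0 < t -> exists zm : int -> int,
        [/\ forall x, \forall s \near t^'-, z s x = zm x,
            forall k, ring k t ->
              if zm (k + 1) < zm k
              then z t k = zm k /\ z t (k + 1) = zm (k + 1)
              else z t k = zm (k + 1) /\ z t (k + 1) = zm k
          & forall x, ~ ring (x - 1) t -> ~ ring x t -> z t x = zm x]].

(* Almost surely every bounded time interval leaves infinitely many edges on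
   both sides of the origin silent; this cuts the line into finite blocks, so
   that the swap rule determines the trajectory from the clocks. *)
Definition colored_TASEP (d : measure_display) (T : measurableType d)
    (R : realType) (P : probability T R) (zeta : R -> T -> int -> int) : Prop :=
  (forall t x c, 0 <= t -> measurable [set w | zeta t w x = c]) /\
  exists N : int -> R -> T -> nat,
    poisson_clocks P N /\
    {ae P, forall w,
      colored_TASEP_path (fun k => rings (fun t => N k t w))
                         (fun t => zeta t w)}.

(* The number of sites left of [y] with color at least [i]; it is [+oo] when
   there are infinitely many of them. *)
Definition height (R : realType) (z : int -> int) (i : int) (y : R) : \bar R :=
  counting [set x : int | x%:~R < y /\ i <= z x].

Definition half_integer (R : realType) (y : R) : Prop :=
  exists m : int, y = m%:~R + 2^-1.

(* Adds 1 to the entry of index [a] for the numbering 1, ..., n of the entries,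
   the ordinal [j : 'I_n] standing for the index [j + 1]. *)
Definition shift_at (V : pzRingType) (n : nat) (a : nat) (f : 'I_n -> V) :
    'I_n -> V :=
  fun j => if j.+1 == a then f j + 1 else f j.

(* Main.v *)
Require Import Defs.
From HB Require Import structures.
From mathcomp Require Import all_boot all_order all_algebra finmap.
From mathcomp Require Import all_classical all_reals all_analysis measurable_realfun.
From mathcomp Require Import zify ring lra.

(* The heights [H k y], the number of sites left of [y] with color at least
   [k], evolve by min-plus linear updates: when the clock of the edge at the cut
   [y] rings, [H k y] becomes [min (H k (y - 1) + 1) (H k (y + 1))]. The crucial
   fact is that the two families [H (k + s) y] and [H k (y - s)], for [s >= 0],
   have the same law, even jointly with all the heights [H k' y'] for [k' <= k]
   and [y <= y']. Turning the successive corners of a chain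
   [(k_1, y_1), (k_2, y_2), ...] in this way gives every chain the law of the
   single-species heights [H k_0 (k_0 + y_j - k_j)], which depends only on the
   differences [y_j - k_j], and these are unchanged by the shift.

   For the crucial fact, time is cut into [K] slots in which the edges ring
   independently and are updated from left to right. This is a product over a
   parallelogram of elements [w + (1 - w) T] of the 0-Hecke algebra, [T] being
   the update of an edge, in which only a rectangle, with [K] rows and one
   column for each line that may go from the right of [k] to the left of [y],
   matters. When the columns of the rectangle carry distinct weights, the
   Yang-Baxter equation exchanges adjacent weights; the resulting linear
   relations are the same for the two families (with reversed weights) and
   determine their laws from the probability of the highest profile, which is
   computed directly. Equal weights follow by specializing a polynomial
   identity. When [K] goes to infinity, the probability that two adjacent edges
   of a finite window ring during the same slot vanishes, and otherwise the
   discrete model is the TASEP. *)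

Set Implicit Arguments.
Unset Strict Implicit.
Unset Printing Implicit Defensive.

Import Order.TTheory GRing.Theory Num.Theory.
Import numFieldNormedType.Exports.

Local Open Scope classical_set_scope.
Local Open Scope ring_scope.

(** * Height functions and 0-Hecke words *)

(** [H k y] stands for the number of sites left of the cut [y] with color at least [k]; the cut [y]
    separates the sites [y - 1] and [y]. *)
Definition state := int -> int -> nat.

(** Sorting the sites [c - 1] and [c] into decreasing order changes only the height at the cut
    between them: the left one is at least [k] as soon as one of the two is, hence the minimum. *)
Definition swap_pos (c : int) (H : state) : state := fun k y =>
  if y == c then minn (H k (c - 1)%R).+1 (H k (c + 1)%R) else H k y.

(** The same update with colors and positions exchanged: the color [c] takes the leftmost of the
    sites of [c - 1] and [c]. This is the 0-Hecke action from the other side. *)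
Definition swap_col (c : int) (H : state) : state := fun k y =>
  if k == c then minn (H (c + 1)%R y).+1 (H (c - 1)%R y) else H k y.

(** Heights of the initial configuration, where the site [x] has color [x]. *)
Definition packed : state := fun k y => if k <= y then absz (y - k)%R else 0%N.

Definition heightlike (H : state) : Prop := forall k y,
  [/\ (H k y <= H k (y + 1)%R)%N, (H k (y + 1)%R <= (H k y).+1)%N,
      (H (k + 1)%R y <= H k y)%N & (H k y <= (H (k + 1)%R y).+1)%N].

Lemma stateP (H G : state) : (forall k y, H k y = G k y) -> H = G.
Proof. by move=> e; apply/funext => k; apply/funext => y. Qed.

Lemma heightlike_packed : heightlike packed.
Proof. by move=> k y; rewrite /packed; split; repeat case: ifP; lia. Qed.

Lemma heightlike_swap_pos c H : heightlike H -> heightlike (swap_pos c H).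
Proof.
move=> hH k y.
have [h1 h2 h3 h4] := hH k (c - 1); have [h5 h6 h7 h8] := hH k (c + 1).
have [i1 i2 i3 i4] := hH k c; rewrite subrK in h1 h2.
rewrite /swap_pos; case: (y =P c) => [->|yc].
  have -> : (c + 1 == c) = false by lia.
  split; lia.
case: (y + 1 =P c) => [e|yc'].
  have -> : y = c - 1 by lia.
  have [j1 j2 j3 j4] := hH k (c - 1 - 1); rewrite subrK in j1 j2.
  split; lia.
by have [] := hH k y; split; lia.
Qed.

Lemma swap_posC c d H : 1 < `|c - d| ->
  swap_pos c (swap_pos d H) = swap_pos d (swap_pos c H).
Proof.
move=> cd; apply: stateP => k y; rewrite /swap_pos.
have -> : (c - 1 == d) = false by lia.
have -> : (c + 1 == d) = false by lia.
have -> : (d - 1 == c) = false by lia.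
have -> : (d + 1 == c) = false by lia.
by case: (y =P c) => [->|//]; have -> : (c == d) = false by lia.
Qed.

Lemma swap_pos_col c d H :
  swap_pos c (swap_col d H) = swap_col d (swap_pos c H).
Proof.
apply: stateP => k y; rewrite /swap_pos /swap_col.
by case: (y =P c); case: (k =P d) => //=; lia.
Qed.

(** For the identity both actions agree. With [swap_pos_col], an update made first can thus be
    turned into an action on colors made last. *)
Lemma swap_pos_packed c : swap_pos c packed = swap_col c packed.
Proof.
apply: stateP => k y; rewrite /swap_pos /swap_col /packed.
by case: (y =P c); case: (k =P c) => //= *; repeat case: ifP; lia.
Qed.

Lemma swap_pos_idem c H : swap_pos c (swap_pos c H) = swap_pos c H.
Proof.
apply: stateP => k y; rewrite /swap_pos.
have -> : (c - 1 == c) = false by lia.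
have -> : (c + 1 == c) = false by lia.
by case: eqP.
Qed.

(** Both sides sort the sites [c - 1], [c], [c + 1]; the increments 0 or 1 of [H] make the nested
    minima agree. *)
Lemma swap_pos_braid c H : heightlike H ->
  swap_pos c (swap_pos (c + 1) (swap_pos c H)) =
  swap_pos (c + 1) (swap_pos c (swap_pos (c + 1) H)).
Proof.
move=> hH; apply: stateP => k y; rewrite /swap_pos addrK eqxx.
have E : ((c - 1 == c) = false) * ((c + 1 == c) = false) *
  ((c - 1 == c + 1) = false) * ((c == c + 1) = false) *
  ((c + 1 + 1 == c) = false) * ((c + 1 + 1 == c + 1) = false).
  by do !split; apply/eqP; lia.
rewrite !E.
have [h1 h2 _ _] := hH k (c - 1); have [h3 h4 _ _] := hH k c.
have [h5 h6 _ _] := hH k (c + 1); rewrite !subrK in h1 h2.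
case: (y =P c) => [->|_].
  by rewrite ?eqxx ?E; lia.
by rewrite eqxx; case: (y =P c + 1) => //; lia.
Qed.

(** * Words in the 0-Hecke algebra and the Yang-Baxter equation *)

Section Programs.
Variable A : comPzRingType.
Implicit Types (phi psi : state -> A) (H : state).

(* The triple [(c, a, b)] stands for the element [a + b T_c] of the 0-Hecke
   algebra; [run l phi H] is the (possibly signed) expectation of [phi] after
   the elements of [l] have acted in turn on [H]. *)
Fixpoint run (l : seq (int * A * A)) phi H : A :=
  if l is x :: l' then
    x.1.2 * run l' phi H + x.2 * run l' phi (swap_pos x.1.1 H)
  else phi H.

Definition cell (c : int) (w : A) : int * A * A := (c, w, 1 - w).
(* [cell c (w / w')] multiplied by [w'], which avoids the division. *)
Definition crossing (c : int) (w w' : A) : int * A * A := (c, w, w' - w).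

Lemma run_cat l1 l2 phi H : run (l1 ++ l2) phi H = run l1 (run l2 phi) H.
Proof. by elim: l1 H => //= x l IH H; rewrite !IH. Qed.

Lemma run_ext_in l phi psi H : (forall G, heightlike G -> phi G = psi G) ->
  heightlike H -> run l phi H = run l psi H.
Proof.
move=> e; elim: l H => [|x l IH] H hH /=; first exact: e.
by rewrite !IH//; apply: heightlike_swap_pos.
Qed.

Lemma run_ext l phi psi H : phi =1 psi -> run l phi H = run l psi H.
Proof. by move=> e; elim: l H => [|x l IH] H //=; rewrite !IH. Qed.

Definition far (c : int) (l : seq (int * A * A)) :=
  all (fun x => 1 < `|c - x.1.1|) l.

Lemma run_far x l phi H : far x.1.1 l ->
  run (x :: l) phi H = run l (run [:: x] phi) H.
Proof.
elim: l H => [|z l IH] H //= /andP[xz /IH {}IH].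
rewrite -!IH /= (swap_posC _ xz); ring.
Qed.

Lemma run_far_cat x l l' phi H : far x.1.1 l ->
  run (x :: l ++ l') phi H = run (l ++ x :: l') phi H.
Proof.
move=> fx; rewrite -cat_cons !run_cat run_far//.
Qed.

(** Idempotence and the braid relation reduce both expansions to the same six products, whose
    polynomial coefficients agree. *)
Lemma run_ybe c w w' l phi H : heightlike H ->
  run [:: crossing (c + 1) w w', cell c w, cell (c + 1) w' & l] phi H =
  run [:: cell c w', cell (c + 1) w, crossing c w w' & l] phi H.
Proof.
by move=> hH /=; rewrite !swap_pos_idem swap_pos_braid //; ring.
Qed.

(** Each row starts one cut further left than the previous one, so the cell of row [r] and column
    [j] of a rectangle acts at the cut [c + j - r]. *)
Fixpoint column (c : int) (K : nat) (w : A) : seq (int * A * A) :=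
  if K is K'.+1 then cell c w :: column (c - 1) K' w else [::].

Fixpoint rect (c : int) (K : nat) (ws : seq A) : seq (int * A * A) :=
  if ws is w :: ws' then column c K w ++ rect (c + 1) K ws' else [::].

Lemma all_column c K w (p : pred int) :
  (forall d, c - K%:Z < d -> d <= c -> p d) ->
  all (fun x => p x.1.1) (column c K w).
Proof.
elim: K c => [|K IH] c //= h; have -> /= : p c by apply: h; [lia|exact: lexx].
by apply: IH => d h1 h2; apply: h; lia.
Qed.

Lemma all_rect c K ws (p : pred int) :
  (forall d, c - K%:Z < d -> d < c + (size ws)%:Z -> p d) ->
  all (fun x => p x.1.1) (rect c K ws).
Proof.
elim: ws c => [|w ws IH] c //= h; rewrite all_cat; apply/andP; split.
  by apply: all_column => d h1 h2; apply: h => //; lia.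
by apply: IH => d h1 h2; apply: h => //; lia.
Qed.

Lemma far_column c d K w : 1 < d - c \/ d - c <= - K%:Z - 1 ->
  far d (column c K w).
Proof. by move=> h; apply: (@all_column _ _ _ (fun x => 1 < `|d - x|)) => e; lia. Qed.

Lemma far_rect c d K ws :
  (size ws)%:Z < d - c \/ d - c <= - K%:Z - 1 -> far d (rect c K ws).
Proof. by move=> h; apply: (@all_rect _ _ _ (fun x => 1 < `|d - x|)) => e; lia. Qed.

Lemma rect_cat c K ws vs :
  rect c K (ws ++ vs) = rect c K ws ++ rect (c + (size ws)%:Z) K vs.
Proof.
elim: ws c => [|w ws IH] c /=; first by rewrite addr0.
by rewrite IH catA; congr (_ ++ rect _ _ _); lia.
Qed.

(** The crossing slides down the two columns, one Yang-Baxter move per row, exchanging their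
    weights, and leaves at the bottom [K] cuts further left. *)
Lemma run_column_swap c K w w' phi H : heightlike H ->
  run (crossing (c + 1) w w' :: column c K w ++ column (c + 1) K w') phi H =
  run (column c K w' ++ column (c + 1) K w ++
       [:: crossing (c + 1 - K%:Z) w w']) phi H.
Proof.
elim: K c phi H => [|K IH] c phi H hH.
  by rewrite /= subr0.
(* The top cell of the second column is at least two cuts away from the rest of the first column, so
   it can be moved up to meet the crossing. *)
have e1 (G : state) : run (column (c - 1) K w ++ column (c + 1) K.+1 w') phi G =
  run (cell (c + 1) w' :: column (c - 1) K w ++ column c K w') phi G.
  rewrite run_far_cat /= ?addrK//.
  by apply: far_column; left => /=; lia.
have e2 (G : state) :
   run (column (c - 1) K w' ++ column (c + 1) K.+1 w ++
     [:: crossing (c + 1 - K.+1%:Z) w w']) phi G =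
   run (cell (c + 1) w :: column (c - 1) K w' ++ column c K w ++
     [:: crossing (c + 1 - K.+1%:Z) w w']) phi G.
  rewrite run_far_cat /= ?addrK//.
  by apply: far_column; left => /=; lia.
transitivity (run [:: crossing (c + 1) w w', cell c w, cell (c + 1) w' &
   column (c - 1) K w ++ column c K w'] phi H).
  by rewrite [LHS]/= !e1.
rewrite run_ybe//.
transitivity (run [:: cell c w', cell (c + 1) w &
   column (c - 1) K w' ++ column c K w ++
     [:: crossing (c + 1 - K.+1%:Z) w w']] phi H); last first.
  by rewrite [RHS]/= !e2.
have e3 (G : state) : heightlike G ->
  run (crossing c w w' :: column (c - 1) K w ++ column c K w') phi G =
  run (column (c - 1) K w' ++ column c K w ++
     [:: crossing (c + 1 - K.+1%:Z) w w']) phi G.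
  move=> hG; have := IH (c - 1) phi G hG; rewrite !subrK => ->.
  by have -> : c - K%:Z = c + 1 - K.+1%:Z by lia.
rewrite (run_cat [:: _; _]) [RHS](run_cat [:: _; _]).
exact: run_ext_in.
Qed.

(** The crossing commutes with the columns of [s1] before it enters and, once out, with those of
    [s2]. *)
Lemma run_rect_swap c K s1 w w' s2 phi H : heightlike H ->
  run (crossing (c + (size s1)%:Z + 1) w w' :: rect c K (s1 ++ [:: w, w' & s2]))
    phi H =
  run (rect c K (s1 ++ [:: w', w & s2]))
    (run [:: crossing (c + (size s1)%:Z + 1 - K%:Z) w w'] phi) H.
Proof.
move=> hH; rewrite !rect_cat -run_cat; set d := c + (size s1)%:Z.
have E v v' : rect d K [:: v, v' & s2] =
    column d K v ++ column (d + 1) K v' ++ rect (d + 2) K s2.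
  by have -> : d + 2 = d + 1 + 1 by lia.
rewrite !E run_far_cat; last by apply: far_rect; left => /=; lia.
rewrite -!catA run_cat [RHS]run_cat; apply: run_ext_in hH => G hG.
rewrite -!cat_cons catA cat_cons run_cat run_column_swap// -run_cat -!catA.
rewrite run_cat [RHS]run_cat; apply: run_ext => G1.
rewrite run_cat [RHS]run_cat; apply: run_ext => G2.
rewrite cat1s -[in LHS](cats0 (rect _ _ _)) run_far_cat// /d.
by apply: far_rect; right => /=; lia.
Qed.

End Programs.

(** * The two profiles and the exchange of adjacent weights *)

Section Observables.
Variable A : comPzRingType.
Implicit Types (phi psi : state -> A) (H G : state).

Lemma run_inv (p : pred int) (I : state -> Prop) l phi psi H :
  (forall c G, p c -> I G -> I (swap_pos c G)) ->
  all (fun x => p x.1.1) l ->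
  (forall G, I G -> phi G = psi G) -> I H -> run l phi H = run l psi H.
Proof.
move=> stab + e; elim: l H => [|x l IH] H /= => [_|/andP[px pl]] HI.
  exact: e.
by rewrite !IH//; apply: stab.
Qed.

Lemma run_linear l a b phi psi H :
  run l (fun G => a * phi G + b * psi G) H = a * run l phi H + b * run l psi H.
Proof. by elim: l H => [|x l IH] H //=; rewrite !IH; ring. Qed.

Lemma run_scale l a phi H : run l (fun G => a * phi G) H = a * run l phi H.
Proof. by elim: l H => [|x l IH] H //=; rewrite !IH; ring. Qed.

Lemma run_sum (J : Type) (r : seq J) l (phi : J -> state -> A) H :
  run l (fun G => \sum_(j <- r) phi j G) H = \sum_(j <- r) run l (phi j) H.
Proof.
elim: l H => [|x l IH] H //=.
by rewrite !IH !big_distrr -big_split.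
Qed.

Lemma run_comp (s : state -> state) l phi H :
  (forall c G, swap_pos c (s G) = s (swap_pos c G)) ->
  run l phi (s H) = run l (phi \o s) H.
Proof. by move=> sC; elim: l H => [|x l IH] H //=; rewrite sC !IH. Qed.

Lemma run_map (B : comPzRingType) (f : {rmorphism A -> B}) l phi H :
  f (run l phi H) =
  run [seq (x.1.1, f x.1.2, f x.2) | x <- l] (fun G => f (phi G)) H.
Proof. by elim: l H => [|x l IH] H //=; rewrite rmorphD !rmorphM !IH. Qed.

(** The quadrant of heights that may be observed jointly with either profile. *)
Definition agree (k y : int) H G :=
  forall k' y', k' <= k -> y <= y' -> H k' y' = G k' y'.

Definition depends (k y : int) phi := forall H G, agree k y H G -> phi H = phi G.

Lemma agree_swap_pos k y c H G : y < c -> agree k y H G ->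
  agree k y (swap_pos c H) (swap_pos c G).
Proof.
move=> yc HG k' y' kk' yy'; rewrite /swap_pos; case: eqP => _; last exact: HG.
by rewrite !HG//; lia.
Qed.

Lemma run_depends k y l phi H G :
  all (fun x => y < x.1.1) l -> depends k y phi -> agree k y H G ->
  run l phi H = run l phi G.
Proof.
move=> + dphi; elim: l H G => [|x l IH] H G /= => [_|/andP[yx yl]] HG.
  exact: dphi.
by congr (_ * _ + _ * _); apply: IH => //; apply: agree_swap_pos.
Qed.

(** The two families to be compared, both starting from the corner [H k y]. *)
Definition profile_in (k y : int) H : nat -> nat := fun i => H (k + i%:Z) y.
Definition profile_out (k y : int) H : nat -> nat := fun i => H k (y - i%:Z).

(** The common effect of a [swap_col] on [profile_in] and of a [swap_pos] on [profile_out]. *)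
Definition bump (i : nat) (v : nat -> nat) : nat -> nat :=
  fun j => if j == i then minn (v i.+1).+1 (v i.-1) else v j.

Lemma profile_in_swap_col k y i H : (0 < i)%N ->
  profile_in k y (swap_col (k + i%:Z) H) = bump i (profile_in k y H).
Proof.
move=> i0; apply/funext => j; rewrite /profile_in /swap_col /bump.
case: (j =P i) => [->|ji].
  by rewrite eqxx; congr (minn (H _ _).+1 (H _ _)); lia.
by case: eqP => //; lia.
Qed.

Lemma profile_out_swap_pos k y i H : (0 < i)%N ->
  profile_out k y (swap_pos (y - i%:Z) H) = bump i (profile_out k y H).
Proof.
move=> i0; apply/funext => j; rewrite /profile_out /swap_pos /bump.
case: (j =P i) => [->|ji].
  by rewrite eqxx; congr (minn (H _ _).+1 (H _ _)); lia.
by case: eqP => //; lia.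
Qed.

Lemma profile_in_swap_pos k y c H : c != y ->
  profile_in k y (swap_pos c H) = profile_in k y H.
Proof.
by move=> cy; apply/funext => j; rewrite /profile_in /swap_pos eq_sym (negPf cy).
Qed.

Lemma profile_out_swap_pos_gt k y c H : y < c ->
  profile_out k y (swap_pos c H) = profile_out k y H.
Proof.
move=> cy; apply/funext => j; rewrite /profile_out /swap_pos.
by case: eqP => //; lia.
Qed.

Lemma profile_in_swap_col_lt k y c H : c < k ->
  profile_in k y (swap_col c H) = profile_in k y H.
Proof.
move=> ck; apply/funext => j; rewrite /profile_in /swap_col.
by case: eqP => //; lia.
Qed.

Lemma profile_out_swap_col k y c H : c != k ->
  profile_out k y (swap_col c H) = profile_out k y H.
Proof.
by move=> ck; apply/funext => j; rewrite /profile_out /swap_col eq_sym (negPf ck).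
Qed.

Lemma depends_swap_pos k y c g : depends k y g -> c < y ->
  forall H, g (swap_pos c H) = g H.
Proof.
move=> dg cy H; apply: dg => k' y' _ yy'; rewrite /swap_pos.
by case: eqP => //; lia.
Qed.

Lemma depends_swap_col k y c g : depends k y g -> k < c ->
  forall H, g (swap_col c H) = g H.
Proof.
move=> dg cy H; apply: dg => k' y' kk' _; rewrite /swap_col.
by case: eqP => //; lia.
Qed.

Variables (k : int) (K : nat).

(** The cut of the last cell of a rectangle with [M] columns and [K] rows whose first cell is at the
    cut [k]. *)
Definition level (M : nat) : int := k + M%:Z - K%:Z.

Definition law_in (g : state -> A) (psi : (nat -> nat) -> A) (ws : seq A) : A :=
  run (rect k K ws) (fun H => g H * psi (profile_in k (level (size ws)) H)) packed.

Definition law_out (g : state -> A) (psi : (nat -> nat) -> A) (ws : seq A) : A :=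
  run (rect k K ws) (fun H => g H * psi (profile_out k (level (size ws)) H)) packed.

(** The crossing made first acts on [packed] as a [swap_col] at a color above [k], which bumps the
    profile and is not seen by [g]. It leaves at a cut below [y], where neither [g] nor the profile
    sees it, and only contributes its total mass [w']. *)
Lemma law_in_swap g (psi : (nat -> nat) -> A) s1 w w' s2 :
  depends k (level (size (s1 ++ [:: w, w' & s2]))) g ->
  w' * law_in g psi (s1 ++ [:: w', w & s2]) =
  w * law_in g psi (s1 ++ [:: w, w' & s2]) +
  (w' - w) * law_in g (psi \o bump (size s1).+1) (s1 ++ [:: w, w' & s2]).
Proof.
rewrite /law_in; set y := level (size (s1 ++ [:: w', w & s2])).
have -> : level (size (s1 ++ [:: w, w' & s2])) = y by rewrite /y !size_cat.
have yE : y = k + (size s1)%:Z + 2 + (size s2)%:Z - K%:Z.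
  by rewrite /y /level size_cat /=; lia.
move=> dg; set phi := fun H => g H * psi (profile_in k y H).
have := run_rect_swap k K s1 w w' s2 phi heightlike_packed.
rewrite [LHS]/= swap_pos_packed run_comp; last by move=> *; rewrite swap_pos_col.
have -> : k + (size s1)%:Z + 1 = k + (size s1).+1%:Z by lia.
have -> : phi \o swap_col (k + (size s1).+1%:Z) =
    fun H => g H * (psi \o bump (size s1).+1) (profile_in k y H).
  apply/funext => H; rewrite /phi /= profile_in_swap_col//.
  by rewrite (depends_swap_col dg)//; lia.
set c := (X in crossing X _ _); have cy : c < y by rewrite /c; lia.
move=> ->; rewrite -run_scale; apply: run_ext => H /=.
rewrite /phi (depends_swap_pos dg cy) profile_in_swap_pos; first by ring.
by rewrite lt_eqF.
Qed.

(** The roles are exchanged: the entering crossing, at a color above [k], is invisible and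
    contributes [w'], while the leaving one bumps the profile. Hence the opposite order of the
    weights. *)
Lemma law_out_swap g (psi : (nat -> nat) -> A) s1 w w' s2 :
  depends k (level (size (s1 ++ [:: w, w' & s2]))) g ->
  w' * law_out g psi (s1 ++ [:: w, w' & s2]) =
  w * law_out g psi (s1 ++ [:: w', w & s2]) +
  (w' - w) * law_out g (psi \o bump (size s2).+1) (s1 ++ [:: w', w & s2]).
Proof.
rewrite /law_out; set y := level (size (s1 ++ [:: w', w & s2])).
have -> : level (size (s1 ++ [:: w, w' & s2])) = y by rewrite /y !size_cat.
have yE : y = k + (size s1)%:Z + 2 + (size s2)%:Z - K%:Z.
  by rewrite /y /level size_cat /=; lia.
move=> dg; set phi := fun H => g H * psi (profile_out k y H).
have := run_rect_swap k K s1 w w' s2 phi heightlike_packed.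
rewrite [LHS]/= swap_pos_packed run_comp; last by move=> *; rewrite swap_pos_col.
have -> : phi \o swap_col (k + (size s1)%:Z + 1) = phi.
  apply/funext => H; rewrite /phi /= profile_out_swap_col; last by lia.
  by rewrite (depends_swap_col dg)//; lia.
have -> (a b c : A) : a * c + (b - a) * c = b * c by ring.
move=> ->; rewrite -run_linear; apply: run_ext => H /=.
have -> : k + (size s1)%:Z + 1 - K%:Z = y - (size s2).+1%:Z by lia.
by rewrite /phi profile_out_swap_pos// (depends_swap_pos dg)//; lia.
Qed.

End Observables.

(** * Invariants of a rectangle and the probability of the highest profile *)

Lemma heightlike_pos H k y n : heightlike H ->
  (H k y <= H k (y + n%:Z)%R <= H k y + n)%N.
Proof.
move=> hH; elim: n => [|n IH]; first by rewrite addr0 addn0 leqnn.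
have [h1 h2 _ _] := hH k (y + n%:Z).
have -> : y + n.+1%:Z = y + n%:Z + 1 by lia.
lia.
Qed.

Lemma heightlike_pos_le H k y y' : heightlike H -> y <= y' ->
  (H k y <= H k y')%N /\ (H k y' <= H k y + absz (y' - y)%R)%N.
Proof.
move=> hH yy'; have := heightlike_pos k y (absz (y' - y)) hH.
have -> : y + (absz (y' - y))%:Z = y' by lia.
by move/andP.
Qed.

Lemma heightlike_col H k y n : heightlike H ->
  (H (k + n%:Z)%R y <= H k y <= H (k + n%:Z)%R y + n)%N.
Proof.
move=> hH; elim: n => [|n IH]; first by rewrite addr0 addn0 leqnn.
have [_ _ h1 h2] := hH (k + n%:Z) y.
have -> : k + n.+1%:Z = k + n%:Z + 1 by lia.
lia.
Qed.

Lemma heightlike_col_le H k k' y : heightlike H -> k <= k' ->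
  (H k' y <= H k y)%N /\ (H k y <= H k' y + absz (k' - k)%R)%N.
Proof.
move=> hH kk'; have := heightlike_col k y (absz (k' - k)) hH.
have -> : k + (absz (k' - k))%:Z = k' by lia.
by move/andP.
Qed.

(* Invariant of the action on [packed] of a rectangle with left end [lo] and
   right end [hi]. *)
Definition reachable (k lo hi : int) (H : state) : Prop :=
  [/\ heightlike H, H k lo = 0%N & H hi hi = 0%N].

Lemma reachable_packed k lo hi : lo <= k -> reachable k lo hi packed.
Proof.
move=> lk; split; [exact: heightlike_packed| |]; rewrite /packed; case: ifP; lia.
Qed.

Lemma reachable_swap_pos k lo hi c H : lo < c < hi -> reachable k lo hi H ->
  reachable k lo hi (swap_pos c H).
Proof.
move=> /andP[lc ch] [hH h1 h2]; split; first exact: heightlike_swap_pos.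
- by rewrite /swap_pos lt_eqF.
- by rewrite /swap_pos gt_eqF.
Qed.

Section Extremal.
Variable A : comPzRingType.
Implicit Types (phi psi : state -> A) (H G : state) (c y : int).

Lemma run_reachable k lo hi l phi psi H :
  all (fun x => lo < x.1.1 < hi) l ->
  (forall G, reachable k lo hi G -> phi G = psi G) ->
  reachable k lo hi H -> run l phi H = run l psi H.
Proof.
move=> la e rH.
apply: (@run_inv _ (fun c => lo < c < hi) (reachable k lo hi)) => //.
by move=> c G; apply: reachable_swap_pos.
Qed.

Lemma run_rect_reachable k K (ws : seq A) phi psi :
  (forall G, reachable k (k - K%:Z) (k + (size ws)%:Z) G -> phi G = psi G) ->
  run (rect k K ws) phi packed = run (rect k K ws) psi packed.
Proof.
move=> e; apply: (run_reachable _ e); last by apply: reachable_packed; lia.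
by apply: (@all_rect _ _ _ _ (fun c => _ < c < _)) => d; lia.
Qed.

Fixpoint sweep (c : int) (K : nat) (H : state) : state :=
  if K is K'.+1 then sweep (c - 1) K' (swap_pos c H) else H.

(** The site [c] has color at least [k]. Each update brings such a color one site to the left, so
    the minimum is always [H k (y - 1) + 1]. *)
Lemma sweepE c K H (k : int) y : heightlike H -> H k (c + 1)%R = (H k c).+1 ->
  sweep c K H k y =
  if (c - K%:Z < y) && (y <= c) then (H k (y - 1)%R).+1 else H k y.
Proof.
elim: K c H y => [|K IH] c H y hH e /=; first by rewrite ifF//; lia.
have [h1 h2 _ _] := hH k (c - 1); rewrite subrK in h1 h2.
have cc : (c - 1 == c) = false by lia.
rewrite IH; last 2 first.
- exact: heightlike_swap_pos.
- by rewrite subrK /swap_pos eqxx cc e; lia.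
rewrite /swap_pos; case: (y =P c) => [->|yc].
  by rewrite cc e ifF ?ifT; lia.
have -> : (c - 1 - K%:Z < y <= c - 1) = (c - K.+1%:Z < y <= c) by lia.
by case: ifP => // h; have -> : (y - 1 == c) = false by lia.
Qed.

(** If some cell of the column does not swap, the height at its cut stays 0, and then so does the
    height at the last cut. The event therefore forces all [K] swaps. *)
Lemma run_column_sweep (k : int) c K (w : A) phi H : heightlike H ->
  H k c = 0%N -> H k (c + 1)%R = 1%N ->
  run (column c K w) (fun G => (G k (c - K%:Z + 1) == 1%N)%:R * phi G) H =
  (1 - w) ^+ K * phi (sweep c K H).
Proof.
elim: K c H => [|K IH] c H hH h0 h1 /=; first by rewrite subr0 h1 !mul1r.
have -> : c - K.+1%:Z + 1 = c - 1 - K%:Z + 1 by lia.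
have [g1 g2 _ _] := hH k (c - 1); rewrite subrK in g1 g2.
have cc : (c - 1 == c) = false by lia.
rewrite (IH _ (swap_pos c H)); last 3 first.
- exact: heightlike_swap_pos.
- by rewrite /swap_pos cc; lia.
- by rewrite subrK /swap_pos eqxx h1; lia.
(* When the first cell does not swap, the remaining ones act left of [c] and the event fails;
   [0 * 1] is the zero observable in a form suited to [run_scale]. *)
rewrite (@run_inv _ (fun d => d < c) (fun G => heightlike G /\ G k c = 0%N)
  _ _ (fun=> 0 * 1)).
- by rewrite (run_scale _ 0 (fun=> 1)) mul0r mulr0 add0r mulrA exprS.
- move=> d G dc [hG G0]; split; first exact: heightlike_swap_pos.
  by rewrite /swap_pos gt_eqF.
- by apply: (@all_column _ _ _ _ (fun d => d < c)) => d; lia.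
- move=> G [hG G0].
  have [h _] := @heightlike_pos_le G k (c - 1 - K%:Z + 1) c hG ltac:(lia).
  by have -> : G k (c - 1 - K%:Z + 1) = 0%N; [lia|rewrite !mul0r].
- by [].
Qed.

(** The configuration moved one site to the right, with one more site, of color above all [k], on
    its left. *)
Definition shift (H : state) : state := fun k y => (H k (y - 1)%R).+1.

Lemma shift_swap_pos c H : swap_pos (c + 1) (shift H) = shift (swap_pos c H).
Proof.
apply: stateP => k y; rewrite /swap_pos /shift.
have -> : (y == c + 1) = (y - 1 == c) by lia.
case: ifP => // _; have -> : c + 1 - 1 - 1 = c - 1 by lia.
have -> : c + 1 + 1 - 1 = c + 1 by lia.
lia.
Qed.

Lemma run_column_shift c K (w : A) phi H :
  run (column (c + 1) K w) phi (shift H) = run (column c K w) (phi \o shift) H.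
Proof.
elim: K c H => [|K IH] c H //=.
have -> : c + 1 - 1 = c - 1 + 1 by lia.
by rewrite shift_swap_pos !IH.
Qed.

Lemma run_rect_shift c K (ws : seq A) phi H :
  run (rect (c + 1) K ws) phi (shift H) = run (rect c K ws) (phi \o shift) H.
Proof.
elim: ws c H => [|w ws IH] c H //=.
rewrite !run_cat run_column_shift; apply: run_ext => G /=.
exact: IH.
Qed.

Lemma depends_shift k y phi : depends k y phi -> depends k (y - 1) (phi \o shift).
Proof.
move=> d H G HG; apply: d => k' y' kk' yy'.
by rewrite /shift HG//; lia.
Qed.

Variables (k : int) (K : nat).

(** For a staircase, these two values force the highest profile starting at [r], which is constant
    and then falls by unit steps; see [staircase_peak]. *)
Definition peak (M r : nat) : (nat -> nat) -> A :=
  fun v => ((v 0%N == r) && (v (M - r)%N == r))%:R.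

(** The peak forces every cell of the first column to swap. What this leaves on the region seen
    later is [shift packed], hence the same problem with one column less. *)
Lemma law_out_peakS g w (ws : seq A) r : (r <= size ws)%N ->
  depends k (level k K (size ws).+1) g ->
  law_out k K g (peak (size ws).+1 r.+1) (w :: ws) =
  (1 - w) ^+ K * law_out k K (g \o shift) (peak (size ws) r) ws.
Proof.
move=> rM dg; rewrite /law_out [rect _ _ (w :: _)]/= run_cat.
set y := level k K (size (w :: ws)).
have yE : y = k + (size ws)%:Z + 1 - K%:Z by rewrite /y /level /=; lia.
set phi := fun H => g H * _.
have dphi : depends k (k - K%:Z + 1) phi.
  move=> H G HG; rewrite /phi /peak /profile_out (dg H G); last first.
    by move=> k' y' kk' yy'; apply: HG => //; move: yy'; rewrite /level; lia.
  by rewrite !HG//; lia.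
transitivity (run (column k K w) (fun G => (G k (k - K%:Z + 1) == 1%N)%:R *
   run (rect (k + 1) K ws) phi G) packed).
  (* The height is 0 at the cut [k - K] and [r + 1] at the cut [k - K + 1 + r], so it rises at each
     step and is 1 at [k - K + 1]. *)
  transitivity (run (rect k K (w :: ws))
    (fun G => (G k (k - K%:Z + 1) == 1%N)%:R * phi G) packed).
    rewrite -run_cat; apply: (@run_rect_reachable k K (w :: ws)) => G [hG G0 _].
    rewrite /phi /peak /profile_out.
    case: (G k (k - K%:Z + 1) =P 1%N) => [_|h1]; first by rewrite mul1r.
    rewrite mul0r subSS; case: (_ =P r.+1) => _ //=; last by rewrite mulr0.
    case: eqP => h2; last by rewrite mulr0.
    have [_] := @heightlike_pos_le G k (k - K%:Z + 1) (y - (size ws - r)%:Z) hG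
      ltac:(lia).
    have [] := hG k (k - K%:Z); lia.
  rewrite /= run_cat; apply: run_ext => G.
  rewrite (@run_inv _ (fun c => k - K%:Z + 1 < c)
    (fun G' => G' k (k - K%:Z + 1) = G k (k - K%:Z + 1))
    _ _ (fun G' => (G k (k - K%:Z + 1) == 1%N)%:R * phi G')) ?run_scale//.
  - by move=> c G' lc; rewrite {1}/swap_pos lt_eqF.
  - by apply: (@all_rect _ _ _ _ (fun c => k - K%:Z + 1 < c)) => d; lia.
  - by move=> G' ->.
rewrite run_column_sweep; last 3 first.
- exact: heightlike_packed.
- by rewrite /packed; case: ifP; lia.
- by rewrite /packed; case: ifP; lia.
congr (_ * _); rewrite (@run_depends _ k (k - K%:Z + 1) _ _ _ (shift packed))//.
- rewrite run_rect_shift; apply: run_ext => H.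
  rewrite /phi /peak /profile_out /shift /= !eqSS.
  by congr (_ * ((H _ _ == _) && (H _ _ == _))%:R); rewrite /y /level /=; lia.
- by apply: (@all_rect _ _ _ _ (fun c => k - K%:Z + 1 < c)) => d; lia.
move=> k' y' kk' yy'; rewrite sweepE; last 2 first.
- exact: heightlike_packed.
- by rewrite /packed; do 2!case: ifP; lia.
by rewrite /shift /packed; repeat case: ifP; lia.
Qed.

(** Here it is the last column that must swap throughout. Since [law_out_peakS] removes the first
    weight instead, the two laws are compared with reversed weights. *)
Lemma law_in_peakS g w (ws : seq A) r : (r <= size ws)%N ->
  depends k (level k K (size ws).+1) g ->
  law_in k K g (peak (size ws).+1 r.+1) (rcons ws w) =
  (1 - w) ^+ K * law_in k K (g \o shift) (peak (size ws) r) ws.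
Proof.
move=> rM dg; rewrite /law_in -cats1 rect_cat /= cats0 run_cat.
set y := level k K (size (ws ++ [:: w])); set c := k + (size ws)%:Z.
have yE : y = c - K%:Z + 1 by rewrite /y /level size_cat /=; lia.
rewrite -run_scale.
transitivity (run (rect k K ws) (run (column c K w) (fun G =>
    (G c (c - K%:Z + 1) == 1%N)%:R *
     (g G * peak (size ws).+1 r.+1 (profile_in k y G)))) packed).
  (* The height at [y] is [r + 1] for the color [c - r] and 0 for the color [c + 1], so it drops at
     each color and is 1 for [c]. *)
  have := @run_rect_reachable k K (ws ++ [:: w]).
  rewrite rect_cat /= cats0 => E; rewrite -!run_cat; apply: E => G [hG _ G0].
  rewrite /peak /profile_in -yE.
  case: (G c y =P 1%N) => [_|h1]; first by rewrite mul1r.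
  rewrite mul0r subSS; case: (_ =P r.+1) => _ //=; last by rewrite mulr0.
  case: eqP => h2; last by rewrite mulr0.
  have {}G0 : G (c + 1) (c + 1) = 0%N.
    by move: G0; rewrite size_cat /=; have -> : k + (size ws + 1)%N%:Z = c + 1 by lia.
  have [] := @heightlike_pos_le G (c + 1) y (c + 1) hG ltac:(lia).
  have [] := @heightlike_col_le G (k + (size ws - r)%N%:Z) c y hG ltac:(lia).
  have [_ _] := hG c y; rewrite G0; lia.
(* The first columns act left of [c], so the heights at the cuts from [c] on are still those of
   [packed]. *)
apply: (@run_inv _ (fun d => d < c) (fun G => heightlike G /\
   forall k' y', c <= y' -> G k' y' = packed k' y')).
- move=> d G dc [hG hp]; split; first exact: heightlike_swap_pos.
  by move=> k' y' cy'; rewrite /swap_pos gt_eqF ?hp//; lia.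
- by apply: (@all_rect _ _ _ _ (fun d => d < c)) => d; lia.
- move=> G [hG hp].
  have hS k' : k' <= c -> G k' (c + 1)%R = (G k' c).+1.
    by move=> kc; rewrite !hp; [|lia..]; rewrite /packed; do 2!case: ifP; lia.
  rewrite run_column_sweep//; last 2 first.
  - by rewrite hp// /packed; case: ifP; lia.
  - by rewrite hp; [|lia]; rewrite /packed; case: ifP; lia.
  have E k' y' : k' <= c -> y <= y' -> sweep c K G k' y' = shift G k' y'.
    move=> kc yy'; rewrite sweepE ?hS//; case: ifP => // h.
    by rewrite /shift !hp; [|lia..]; rewrite /packed; do 2!case: ifP; lia.
  congr (_ * (_ * _)).
    by apply: dg => k' y' kk'; rewrite /level => yy'; apply: E; lia.
  rewrite /peak /profile_in !E; [|lia..]; rewrite /shift !eqSS.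
  by congr ((G _ _ == _) && (G _ _ == _))%:R; rewrite /y /level size_cat /=; lia.
- by split; [exact: heightlike_packed|].
Qed.

End Extremal.

(** * Distinct column weights *)

(** Adjacent exchanges carry the first letter to the end; the remaining ones are reversed by
    induction. *)
Lemma rev_adjacent_invariant (T U : Type) (n : nat) (f : seq T -> U) :
  (forall s1 w w' s2, size (s1 ++ [:: w, w' & s2]) = n ->
     f (s1 ++ [:: w, w' & s2]) = f (s1 ++ [:: w', w & s2])) ->
  forall s, size s = n -> f (rev s) = f s.
Proof.
move=> fC.
have mv s1 w s s2 : size (s1 ++ w :: s ++ s2) = n ->
    f (s1 ++ w :: s ++ s2) = f (s1 ++ s ++ w :: s2).
  elim: s s1 => [//|w' s IH] s1 sz; rewrite fC//.
  rewrite -cat_rcons IH ?cat_rcons//.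
  by move: sz; rewrite !size_cat /= !size_cat; lia.
suff gen p s : size (p ++ s) = n -> f (p ++ rev s) = f (p ++ s).
  by move=> s; apply: (gen [::]).
elim: s p => [//|w s IH] p sz; rewrite rev_cons -cats1.
have := mv p w (rev s) [::]; rewrite cats0 => <-; last first.
  by move: sz; rewrite !size_cat /= size_rev.
by rewrite -cat_rcons IH cat_rcons.
Qed.

(** The shape of both profiles of a reachable state. *)
Definition staircase (M : nat) (v : nat -> nat) : Prop :=
  (forall i, (i < M)%N -> (v i.+1 <= v i <= (v i.+1).+1)%N) /\ v M = 0%N.

Lemma staircase_le M v i j : staircase M v -> (i <= j)%N -> (j <= M)%N ->
  (v j <= v i <= v j + (j - i))%N.
Proof.
move=> [vS _] ij jM; rewrite -(subnKC ij) in jM *.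
elim: (j - i)%N jM => [|n IH] jM; first by rewrite addn0; lia.
have := vS (i + n)%N; rewrite addnS in jM *; have := IH ltac:(lia).
lia.
Qed.

Lemma staircase_peak M v r : (r <= M)%N -> staircase M v ->
  v 0%N = r -> v (M - r)%N = r ->
  forall i, (i <= M)%N -> v i = minn r (M - i).
Proof.
move=> rM vS v0 vr i iM; have [_ vM] := vS.
have := staircase_le vS (leq0n i) iM.
have := staircase_le vS iM (leqnn M); rewrite vM.
have [ir|ri] := leqP i (M - r).
  have := staircase_le vS ir ltac:(lia); lia.
have := staircase_le vS (ltnW ri) iM; lia.
Qed.

(** If no descent is followed by a flat step, all steps after the first descent are descents. *)
Lemma staircase_valley M v : staircase M v ->
  (forall i, (i <= M)%N -> v i = minn (v 0%N) (M - i)) \/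
  exists i, [/\ (0 < i < M)%N, v i.-1 = (v i).+1 & v i.+1 = v i].
Proof.
move=> vS; have [st vM] := vS.
have [/existsP[i /and3P[i0 /eqP h1 /eqP h2]]|/existsPn h] :=
  boolP [exists i : 'I_M, [&& (0 < i)%N, v i.-1 == (v i).+1 & v i.+1 == v i]].
  by right; exists i; split => //; rewrite i0 ltn_ord.
left; suff flat j : (j < M)%N -> v j = (v j.+1).+1 ->
    forall i, (j <= i <= M)%N -> v i = (M - i)%N.
  elim=> [|i IH] iM.
    have := staircase_le vS iM (leqnn M); lia.
  have := IH ltac:(lia); have := st i iM.
  have := staircase_le vS iM (leqnn M); rewrite vM.
  have [e|e] := v i =P (v i.+1).+1; last by lia.
  have := flat i iM e i ltac:(lia).
  have := flat i iM e i.+1 ltac:(lia).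
  have := staircase_le vS (leq0n i.+1) iM.
  lia.
move=> jM e; suff dn n : (j + n < M)%N -> v (j + n)%N = (v (j + n).+1).+1.
  have dn' n : (j + n <= M)%N -> v j = (v (j + n) + n)%N.
    elim: n => [|n IH] jn; first by rewrite !addn0.
    by have := dn n; have := IH ltac:(lia); rewrite addnS in jn *; lia.
  move=> i /andP[ji iM].
  have := dn' (i - j)%N; have := dn' (M - j)%N; rewrite !subnKC//; lia.
elim: n => [|n IH] jn; first by rewrite addn0.
rewrite addnS in jn *; have {}IH := IH ltac:(lia).
have := h (Ordinal jn); rewrite /= IH eqxx /=; have := st _ jn.
by case: eqP => //; lia.
Qed.

Section Distinct.
Variable A : idomainType.
Variables (k : int) (K : nat).
Implicit Types (g : state -> A) (ws : seq A).

Definition indic (M : nat) (v : nat -> nat) : (nat -> nat) -> A :=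
  fun u => (all (fun i => u i == v i) (iota 0 M.+1))%:R.

Lemma indicP M (v u : nat -> nat) : reflect (forall i, (i <= M)%N -> u i = v i)
  (all (fun i => u i == v i) (iota 0 M.+1)).
Proof.
apply: (iffP allP) => h i.
  by move=> iM; apply/eqP/h; rewrite mem_iota.
by rewrite mem_iota ltnS => /andP[_ /h ->].
Qed.

Lemma profile_in_staircase M H :
  reachable k (k - K%:Z) (k + M%:Z) H -> staircase M (profile_in k (level k K M) H).
Proof.
move=> [hH _ h0]; split => [i iM|].
  have [_ _ h1 h2] := hH (k + i%:Z) (level k K M).
  have e : k + i.+1%:Z = k + i%:Z + 1 by lia.
  by rewrite /profile_in e h1 h2.
have [+ _] := @heightlike_pos_le H (k + M%:Z) (level k K M) (k + M%:Z) hH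
  ltac:(rewrite /level; lia).
by rewrite h0 /profile_in; lia.
Qed.

Lemma profile_out_staircase M H :
  reachable k (k - K%:Z) (k + M%:Z) H -> staircase M (profile_out k (level k K M) H).
Proof.
move=> [hH h0 _]; split => [i iM|].
  have [h1 h2 _ _] := hH k (level k K M - i.+1%:Z).
  rewrite /profile_out.
  have e : level k K M - i%:Z = level k K M - i.+1%:Z + 1 by lia.
  by rewrite e h1 h2.
by rewrite -h0 /profile_out; congr (H _ _); rewrite /level; lia.
Qed.

Lemma law_in_ext g psi1 psi2 ws :
  (forall v, staircase (size ws) v -> psi1 v = psi2 v) ->
  law_in k K g psi1 ws = law_in k K g psi2 ws.
Proof.
move=> e; apply: run_rect_reachable => G rG.
by rewrite e//; apply: profile_in_staircase.
Qed.

Lemma law_out_ext g psi1 psi2 ws :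
  (forall v, staircase (size ws) v -> psi1 v = psi2 v) ->
  law_out k K g psi1 ws = law_out k K g psi2 ws.
Proof.
move=> e; apply: run_rect_reachable => G rG.
by rewrite e//; apply: profile_out_staircase.
Qed.

Lemma law_inD g psi1 psi2 ws : law_in k K g (fun u => psi1 u + psi2 u) ws =
  law_in k K g psi1 ws + law_in k K g psi2 ws.
Proof.
rewrite /law_in -[X in X + _]mul1r -[X in _ + X]mul1r -run_linear.
by apply: run_ext => H; ring.
Qed.

Lemma law_outD g psi1 psi2 ws : law_out k K g (fun u => psi1 u + psi2 u) ws =
  law_out k K g psi1 ws + law_out k K g psi2 ws.
Proof.
rewrite /law_out -[X in X + _]mul1r -[X in _ + X]mul1r -run_linear.
by apply: run_ext => H; ring.
Qed.

(** A staircase starting at 0 vanishes, so both events say that the corner height is 0. *)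
Lemma law_peak0 g ws : law_in k K g (peak A (size ws) 0) ws =
  law_out k K g (peak A (size ws) 0) ws.
Proof.
apply: run_rect_reachable => G rG.
have [_ h1] := profile_in_staircase rG; have [_ h2] := profile_out_staircase rG.
by rewrite /peak subn0 h1 h2 /profile_in /profile_out addr0 subr0.
Qed.

(** [bump] does not touch the index 0 here, so the exchange relation says that the two sides agree
    after multiplication by [w'], and by symmetry by [w]; distinct weights are not both 0. *)
Lemma law_out_peak0_swap g s1 w w' s2 :
  depends k (level k K (size (s1 ++ [:: w, w' & s2]))) g ->
  law_out k K g (peak A (size (s1 ++ [:: w, w' & s2])) 0) (s1 ++ [:: w, w' & s2]) =
  law_out k K g (peak A (size (s1 ++ [:: w, w' & s2])) 0) (s1 ++ [:: w', w & s2]).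
Proof.
move=> dg; set M := size _ in dg *.
have eM : size (s1 ++ [:: w', w & s2]) = M by rewrite /M !size_cat.
pose psi0 (v : nat -> nat) : A := (v 0%N == 0%N)%:R.
have E ws : size ws = M ->
    law_out k K g (peak A M 0) ws = law_out k K g psi0 ws.
  move=> <-; apply: law_out_ext => v [_ vM].
  by rewrite /peak subn0 vM eqxx andbT.
rewrite !E//.
have [->//|ww'] := eqVneq w w'.
have := law_out_swap psi0 (w := w) (w' := w') dg.
rewrite -[psi0 \o _]/psi0 -mulrDl addrC subrK.
have := law_out_swap (k := k) (K := K) (g := g) psi0 (s1 := s1) (w := w')
  (w' := w) (s2 := s2).
rewrite eM -[psi0 \o _]/psi0 -mulrDl [w' + _]addrC subrK => /(_ dg).
have [w0|w0] := eqVneq w 0; last by move=> /(mulfI w0).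
by move=> _; move: ww'; rewrite w0 eq_sym => w'0 /(mulfI w'0).
Qed.

Lemma law_out_peak0_rev g ws : depends k (level k K (size ws)) g ->
  law_out k K g (peak A (size ws) 0) (rev ws) =
  law_out k K g (peak A (size ws) 0) ws.
Proof.
move=> dg; apply: (@rev_adjacent_invariant _ _ (size ws)) => // s1 w w' s2 e.
by have := @law_out_peak0_swap g s1 w w' s2; rewrite e; apply.
Qed.

Lemma law_peak g ws r : (r <= size ws)%N -> depends k (level k K (size ws)) g ->
  law_in k K g (peak A (size ws) r) ws =
  law_out k K g (peak A (size ws) r) (rev ws).
Proof.
elim: r ws g => [|r IH] ws g; first by rewrite law_peak0 => _ /law_out_peak0_rev ->.
case/lastP: ws => [//|ws w]; rewrite size_rcons ltnS rev_rcons => rM dg.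
have := law_out_peakS (g := g) w (ws := rev ws) (r := r).
rewrite law_in_peakS// size_rev => ->//; rewrite IH//.
have -> : level k K (size ws) = level k K (size ws).+1 - 1.
  by rewrite /level; lia.
exact: depends_shift.
Qed.

(** [bump] writes [v i + 1] between the neighbors of the valley. Thus [bump i u] is [v'] exactly
    when [u] agrees with [v] off [i], and a staircase then leaves for [u i] only the values of [v]
    and [v']. *)
Lemma indic_bump M (u v v' : nat -> nat) i : staircase M u -> (0 < i < M)%N ->
  v i.-1 = (v i).+1 -> v i.+1 = v i ->
  (forall j, v' j = if j == i then (v i).+1 else v j) ->
  indic M v' (bump i u) = indic M v' u + indic M v u.
Proof.
move=> [uS _] /andP[i0 iM] h1 h2 hv.
have [u1 u2] : (u i <= u i.-1 <= (u i).+1)%N /\ (u i.+1 <= u i <= (u i.+1).+1)%N.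
  by split; [have := uS i.-1; rewrite prednK//; apply; lia|exact: uS].
have off w : (forall j, (j <= M)%N -> w j = v' j) ->
    forall j, (j <= M)%N -> j != i -> w j = v j.
  by move=> hw j jM ji; rewrite hw// hv (negPf ji).
have ends w : (forall j, (j <= M)%N -> j != i -> w j = v j) ->
    w i.-1 = (v i).+1 /\ w i.+1 = v i.
  by move=> hw; rewrite !hw ?h1 ?h2//; lia.
rewrite /indic; case: (indicP M v' (bump i u)) => hb.
  have hu j : (j <= M)%N -> j != i -> u j = v j.
    by move=> jM ji; rewrite -(off _ hb)// /bump (negPf ji).
  have [e1 e2] := ends _ hu.
  case: (indicP M v' u) => h'; case: (indicP M v u) => h''.
  - by have := h' i (ltnW iM); rewrite hv eqxx h''; lia.
  - by rewrite addr0.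
  - by rewrite add0r.
  - exfalso; have [e|ne] := u i =P v i.
      by apply: h'' => j jM; have [->//|] := eqVneq j i; apply: hu.
    apply: h' => j jM; rewrite hv; have [->|] := eqVneq j i; last exact: hu.
    lia.
have nu : ~ forall j, (j <= M)%N -> j != i -> u j = v j.
  move=> hu; have [e1 e2] := ends _ hu.
  apply: hb => j jM; rewrite hv /bump; case: (j =P i) => [_|/eqP ji].
    by rewrite e1 e2 minnn.
  exact: hu.
case: (indicP M v' u) => h'; first by case: nu; apply: off.
case: (indicP M v u) => h''; first by case: nu => j jM _; apply: h''.
by rewrite addr0.
Qed.

(* By [law_in_swap] and [law_out_swap], the difference of the two laws at [v],
   times the difference of two adjacent weights, is a combination of its values
   at the profile [v'] obtained by filling a valley of [v]. *)
Lemma law_indic_distinct g M v ws : size ws = M -> uniq ws ->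
  depends k (level k K M) g ->
  law_in k K g (indic M v) ws = law_out k K g (indic M v) (rev ws).
Proof.
move=> + + dg; have [vS|nS] := pselect (staircase M v); last first.
  move=> sz _; have z u : staircase M u -> indic M v u = 0.
    move=> uS; rewrite /indic; case: indicP => [e|//].
    case: nS; have [h1 h2] := uS; split=> [i iM|]; last by rewrite -e.
    by rewrite -!e//; [exact: h1|exact: ltnW].
  have run0 l (p : state -> nat -> nat) : run l (fun H => g H * 0) packed = 0.
    by rewrite (run_ext _ (psi := fun H => 0 * g H)) ?run_scale ?mul0r// => H;
       rewrite mulrC.
  rewrite (@law_in_ext _ (indic M v) (fun=> 0)) ?sz//.
  rewrite (@law_out_ext _ (indic M v) (fun=> 0)) ?size_rev ?sz//.
  by rewrite /law_in /law_out !run0.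
(* Induction on the area above the profile, which decreases when a valley is filled; [ws] varies, as
   weights get exchanged. *)
have [n] := ubnP (\sum_(i < M.+1) (M - v i)); elim: n v vS ws => // n IH v vS ws vn sz uws.
have [vmax|[i [/andP[i0 iM] h1 h2]]] := staircase_valley vS.
  have rM : (v 0%N <= size ws)%N.
    by rewrite sz; have := staircase_le vS (leq0n M) (leqnn M); have [_ ->] := vS; lia.
  have E u : staircase M u -> indic M v u = peak A M (v 0%N) u.
    move=> uS; rewrite /indic /peak; case: indicP => [e|ne].
      rewrite (e 0%N)// (e (M - v 0%N)%N) ?leq_subr// eqxx/=.
      by rewrite (vmax (M - v 0%N)%N) ?leq_subr// subKn ?minnn ?eqxx -?sz.
    case: eqP => //= e0; case: eqP => //= e1; case: ne => j jM.
    by rewrite vmax//; apply: (staircase_peak _ uS) => //; rewrite -sz.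
  rewrite (@law_in_ext _ (indic M v) (peak A M (v 0%N))) ?sz//.
  rewrite (@law_out_ext _ (indic M v) (peak A M (v 0%N))) ?size_rev ?sz//.
  by rewrite -sz; apply: law_peak => //; rewrite sz.
pose v' j := if j == i then (v i).+1 else v j.
have v'S : staircase M v'.
  have [st vM] := vS; split=> [j jM|]; rewrite /v'; last first.
    by rewrite gtn_eqF.
  have := st _ jM; case: (j =P i) => [->|ji]; first by rewrite h2; case: eqP; lia.
  case: (j.+1 =P i) => [e|//].
  by move: h1; rewrite -e /=; lia.
have v'n : (\sum_(j < M.+1) (M - v' j) < n)%N.
  have iM' : (i < M.+1)%N by lia.
  rewrite (bigD1 (Ordinal iM'))//= {1}/v' eqxx.
  rewrite (bigD1 (Ordinal iM'))//= in vn.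
  under eq_bigr => j ji.
    rewrite /v' ifF; last by apply/negbTE; move: ji; apply: contra => /eqP ji; apply/eqP/val_inj.
    over.
  have := staircase_le vS (leq0n i.-1) ltac:(lia).
  have := staircase_le vS (_ : i.-1 <= M)%N (leqnn M); have [_ ->] := vS.
  lia.
have wsE : ws = take i.-1 ws ++ [:: nth 0 ws i.-1, nth 0 ws i & drop i.+1 ws].
  rewrite -{1}(cat_take_drop i.-1 ws); congr (_ ++ _).
  rewrite (drop_nth 0) ?sz; last by lia.
  by rewrite prednK// (drop_nth 0) ?sz.
set s1 := take _ _ in wsE; set s2 := drop _ _ in wsE.
set w := nth _ _ _ in wsE; set w' := nth _ _ _ in wsE.
have s1E : (size s1).+1 = i by rewrite /s1 size_take sz ifT; lia.
have ww' : w' - w != 0.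
  rewrite subr_eq0 /w /w' nth_uniq ?sz//; lia.
pose ws' := s1 ++ [:: w', w & s2].
have sz' : size ws' = M by rewrite -sz wsE !size_cat.
have uws' : uniq ws'.
  rewrite -(perm_uniq (s1 := ws)) // wsE perm_cat2l.
  exact/permPl/(perm_catCA [:: w] [:: w']).
have rE : rev ws = rev s2 ++ [:: w', w & rev s1].
  by rewrite wsE rev_cat !rev_cons -!cats1 -!catA.
have rE' : rev ws' = rev s2 ++ [:: w, w' & rev s1].
  by rewrite /ws' rev_cat !rev_cons -!cats1 -!catA.
(* The word of [law_out] is reversed, so that its index counted from the right is again [i]: both
   relations bump the same place. *)
have := law_in_swap (k := k) (K := K) (g := g) (indic M v') (s1 := s1) (w := w)
  (w' := w') (s2 := s2).
have := law_out_swap (k := k) (K := K) (g := g) (indic M v') (s1 := rev s2)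
  (w := w) (w' := w') (s2 := rev s1).
rewrite -rE -rE' -/ws' -wsE !size_rev sz sz' s1E => /(_ dg) e2 /(_ dg) e1.
rewrite !(IH v') // in e1; rewrite e2 in e1; move/addrI/(mulfI ww'): e1.
have E u : staircase M u ->
    (indic M v' \o bump i) u = indic M v' u + indic M v u.
  by move=> uS; apply: indic_bump => //; rewrite i0.
rewrite (@law_in_ext _ _ (fun u => indic M v' u + indic M v u)) ?sz//.
rewrite (@law_out_ext _ _ (fun u => indic M v' u + indic M v u)) ?size_rev ?sz//.
by rewrite law_inD law_outD !(IH v') // => /addrI.
Qed.

End Distinct.

(** * Equal weights and parallelograms *)

Section Homogeneous.
Variable R : numDomainType.
Implicit Types (g : state -> R) (psi : (nat -> nat) -> R).

Lemma map_column (A B : comPzRingType) (f : {rmorphism A -> B}) c K w :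
  [seq (x.1.1, f x.1.2, f x.2) | x <- column c K w] = column c K (f w).
Proof. by elim: K c => [|K IH] c //=; rewrite IH /cell rmorphB rmorph1. Qed.

Lemma map_rect (A B : comPzRingType) (f : {rmorphism A -> B}) c K ws :
  [seq (x.1.1, f x.1.2, f x.2) | x <- rect c K ws] = rect c K (map f ws).
Proof. by elim: ws c => [|w ws IH] c //=; rewrite map_cat map_column IH. Qed.

(** The polynomial weights [u + j X] are distinct, and all become [u] at [X = 0]. *)
Lemma law_indic_nseq k K g M v (u : R) : depends k (level k K M) g ->
  law_in k K g (indic R M v) (nseq M u) = law_out k K g (indic R M v) (nseq M u).
Proof.
move=> dg.
pose ws := [seq u%:P + (j%:R)%:P * 'X | j <- iota 0 M] : seq {poly R}.
have sz : size ws = M by rewrite size_map size_iota.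
have uws : uniq ws.
  rewrite map_inj_uniq ?iota_uniq// => i j /addrI e.
  have := congr1 (fun p : {poly R} => p`_1) e.
  by rewrite !coefCM coefX !mulr1 => /eqP; rewrite eqr_nat => /eqP.
pose ev : {rmorphism {poly R} -> R} := horner_eval 0.
have evws : map ev ws = nseq M u.
  apply: (@eq_from_nth _ 0); rewrite size_map sz ?size_nseq// => i iM.
  rewrite nth_nseq iM -map_comp (nth_map 0%N) ?size_iota//=.
  by rewrite /horner_eval !hornerE.
have revE : map ev (rev ws) = nseq M u by rewrite map_rev evws rev_nseq.
have dg' : depends k (level k K M) (polyC \o g).
  by move=> H G HG /=; rewrite (dg H G).
have := law_indic_distinct v sz uws dg' => /(congr1 ev).
rewrite /law_in /law_out !run_map !map_rect evws revE size_rev sz size_nseq => E.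
transitivity (run (rect k K (nseq M u)) (fun H => ev ((polyC \o g) H *
    indic {poly R} M v (profile_in k (level k K M) H))) packed).
  by apply: run_ext => H; rewrite rmorphM /= /indic rmorph_nat /ev /horner_eval hornerC.
rewrite E; apply: run_ext => H.
by rewrite rmorphM /= /indic rmorph_nat /ev /horner_eval hornerC.
Qed.

Lemma staircase0 M v i : staircase M v ->
  (forall j, (v j.+1 <= v j)%N) -> (M <= i)%N -> v i = 0%N.
Proof.
move=> [_ vM] dec Mi; rewrite -(subnKC Mi).
elim: (i - M)%N => [|n IH]; first by rewrite addn0.
by have := dec (M + n)%N; rewrite addnS IH; lia.
Qed.

(** [psi] is expanded over the finitely many possible profiles; a profile vanishes past the index
    [M], so its first [M + 1] entries determine it. *)
Lemma law_nseq k K g psi M (u : R) : depends k (level k K M) g ->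
  law_in k K g psi (nseq M u) = law_out k K g psi (nseq M u).
Proof.
move=> dg; pose T := {ffun 'I_M.+1 -> 'I_M.+1}.
pose ext (f : T) : nat -> nat := fun i => if (i <= M)%N then f (inord i) : nat else 0%N.
have decomp v : staircase M v -> (forall j, (v j.+1 <= v j)%N) ->
    psi v = \sum_(f : T) psi (ext f) * indic R M (ext f) v.
  move=> vS dec; pose f0 : T := [ffun i : 'I_M.+1 => inord (v i)].
  have vb i : (i <= M)%N -> (v i < M.+1)%N.
    by move=> iM; have := staircase_le vS iM (leqnn M); have [_ ->] := vS; lia.
  have fv : ext f0 = v.
    apply/funext => i; rewrite /ext; case: leqP => iM.
      by rewrite ffunE (inordK (_ : (i < M.+1)%N))// inordK// vb.
    by rewrite (staircase0 vS)// ltnW.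
  rewrite (bigD1 f0)//= fv /indic; case: indicP => [_|[]//].
  rewrite mulr1 big1 ?addr0// => f ff0; case: indicP => [e|_]; last by rewrite mulr0.
  case/eqP: ff0; apply/ffunP => i; apply/val_inj; rewrite /= ffunE.
  have iM : (i <= M)%N by rewrite -ltnS.
  by rewrite inordK ?vb// e// /ext iM inord_val.
have dec_in H (k0 y : int) : heightlike H ->
    forall j, (profile_in k0 y H j.+1 <= profile_in k0 y H j)%N.
  move=> hH j; rewrite /profile_in.
  by have [] := @heightlike_col_le H (k0 + j%:Z) (k0 + j.+1%:Z) y hH ltac:(lia).
have dec_out H (k0 y : int) : heightlike H ->
    forall j, (profile_out k0 y H j.+1 <= profile_out k0 y H j)%N.
  move=> hH j; rewrite /profile_out.
  by have [] := @heightlike_pos_le H k0 (y - j.+1%:Z) (y - j%:Z) hH ltac:(lia).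
transitivity (\sum_(f : T) psi (ext f) * law_in k K g (indic R M (ext f)) (nseq M u)).
  under eq_bigr do rewrite -run_scale; rewrite -run_sum.
  apply: run_rect_reachable => G; rewrite !size_nseq => rG; have [hG _ _] := rG.
  rewrite (decomp _ (profile_in_staircase rG)); last exact: dec_in.
  by rewrite big_distrr; apply: eq_bigr => f _ /=; ring.
under eq_bigr do rewrite law_indic_nseq//.
under eq_bigr do rewrite -run_scale; rewrite -run_sum.
apply: run_rect_reachable => G; rewrite !size_nseq => rG; have [hG _ _] := rG.
rewrite (decomp _ (profile_out_staircase rG)); last exact: dec_out.
by rewrite big_distrr; apply: eq_bigr => f _ /=; ring.
Qed.

End Homogeneous.

(** * The parallelogram read row by row, that is, by time slots *)

Section Rows.
Variable A : comPzRingType.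
Implicit Types (phi g : state -> A).

Fixpoint row_word (c : int) (ws : seq A) : seq (int * A * A) :=
  if ws is w :: ws' then cell c w :: row_word (c + 1) ws' else [::].

Fixpoint rows_word (c : int) (K : nat) (ws : seq A) : seq (int * A * A) :=
  if K is K'.+1 then row_word c ws ++ rows_word (c - 1) K' ws else [::].

Lemma all_row (c : int) ws (p : pred int) :
  (forall d, c <= d -> p d) -> all (fun x => p x.1.1) (row_word c ws).
Proof.
elim: ws c => [|w ws IH] c //= h; rewrite h//= IH// => d cd.
by apply: h; lia.
Qed.

Lemma run_far_cats l1 l2 l3 phi H : all (fun x => far x.1.1 l2) l1 ->
  run (l1 ++ l2 ++ l3) phi H = run (l2 ++ l1 ++ l3) phi H.
Proof.
elim: l1 l3 H => [|x l1 IH] l3 H //= /andP[xl l1l].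
rewrite -[RHS]run_far_cat//= !IH//.
Qed.

(** The lower cells of a column commute with the later cells of the first row, which are at least
    two cuts to their right. *)
Lemma run_rect_row c K ws phi H :
  run (rect c K.+1 ws) phi H = run (row_word c ws ++ rect (c - 1) K ws) phi H.
Proof.
elim: ws c phi H => [|w ws IH] c phi H //.
transitivity (run (cell c w :: column (c - 1) K w ++ row_word (c + 1) ws ++
    rect c K ws) phi H).
  rewrite -[rect c K.+1 (w :: ws)]/((cell c w :: column (c - 1) K w) ++
    rect (c + 1) K.+1 ws) -cat_cons !run_cat; apply: run_ext => G.
  by rewrite IH addrK run_cat.
have E G : run (column (c - 1) K w ++ row_word (c + 1) ws ++ rect c K ws) phi G =
    run (row_word (c + 1) ws ++ column (c - 1) K w ++ rect c K ws) phi G.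
  apply: run_far_cats.
  apply: (@all_column _ _ _ _ (fun d => far d (row_word (c + 1) ws))) => d _ dc.
  by apply: (@all_row _ _ (fun e => 1 < `|d - e|)) => e; lia.
by rewrite /= !E subrK.
Qed.

Lemma run_rows c K ws phi H :
  run (rows_word c K ws) phi H = run (rect c K ws) phi H.
Proof.
elim: K c phi H => [|K IH] c phi H /=.
  suff -> : rect c 0 ws = [::] by [].
  by elim: ws c => //= w ws IH c; rewrite IH.
by rewrite run_rect_row !run_cat; apply: run_ext => G; apply: IH.
Qed.

(* The updates right of the final cut, and those left of the initial one, only
   act on the heights [H k' y'] with [k' <= k] and [y <= y'] seen by [g]. *)
Lemma absorb_right k y l g : all (fun x => y < x.1.1) l -> depends k y g ->
  exists2 g' : state -> A, depends k y g' &
  (forall psi H, run l (fun G => g G * psi (profile_in k y G)) H =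
                 g' H * psi (profile_in k y H)) /\
  (forall psi H, run l (fun G => g G * psi (profile_out k y G)) H =
                 g' H * psi (profile_out k y H)).
Proof.
move=> yl dg; exists (run l g); first by move=> H G HG; apply: run_depends HG.
split=> psi; elim: l yl => [//|x l IH] /= /andP[yx yl] H; rewrite !IH//.
  by rewrite profile_in_swap_pos ?gt_eqF//; ring.
by rewrite profile_out_swap_pos_gt//; ring.
Qed.

Lemma absorb_left k y l l' g : all (fun x => x.1.1 < k) l -> depends k y g ->
  exists2 g' : state -> A, depends k y g' &
  (forall psi, run (l ++ l') (fun G => g G * psi (profile_in k y G)) packed =
     run l' (fun G => g' G * psi (profile_in k y G)) packed) /\
  (forall psi, run (l ++ l') (fun G => g G * psi (profile_out k y G)) packed =
     run l' (fun G => g' G * psi (profile_out k y G)) packed).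
Proof.
elim: l g => [|[[c a] b] l IH] g /=; first by move=> _ dg; exists g.
move=> /andP[ck lk] dg.
(* An update left of [k] made first is an action on a color below [k]. It commutes with the rest of
   the word, is seen by [g] only, and is folded into it. *)
pose g1 H := a * g H + b * g (swap_col c H).
have dg1 : depends k y g1.
  move=> H G HG; rewrite /g1 (dg _ _ HG); congr (_ + _ * _); apply: dg.
  move=> k' y' kk' yy'; rewrite /swap_col; case: eqP => _; last exact: HG.
  by rewrite !HG//; lia.
have [g' dg' [gin gout]] := IH g1 lk dg1; exists g' => //.
have sC d G : swap_pos d (swap_col c G) = swap_col c (swap_pos d G).
  exact: swap_pos_col.
split=> psi; [rewrite -gin|rewrite -gout].
  rewrite swap_pos_packed run_comp// -run_linear; apply: run_ext => G /=.
  by rewrite profile_in_swap_col_lt// /g1; ring.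
rewrite swap_pos_packed run_comp// -run_linear; apply: run_ext => G /=.
by rewrite profile_out_swap_col ?lt_eqF// /g1; ring.
Qed.

End Rows.

(** The columns starting left of [k] and those staying right of [y] are absorbed into [g]; the
    [y + K - k] others form a rectangle whose last cell is at [y]. *)
Lemma rows_hook (R : numDomainType) (c k y : int) (K L : nat) (u : R)
    (g : state -> R) (psi : (nat -> nat) -> R) :
  c <= k -> k <= y + K%:Z -> y + K%:Z <= c + L%:Z -> depends k y g ->
  run (rows_word c K (nseq L u)) (fun H => g H * psi (profile_in k y H)) packed =
  run (rows_word c K (nseq L u)) (fun H => g H * psi (profile_out k y H)) packed.
Proof.
move=> ck kyK yKL dg; rewrite !run_rows.
pose a := absz (k - c)%R; pose M := absz (y + K%:Z - k)%R.
pose b := absz (c + L%:Z - (y + K%:Z))%R.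
have -> : nseq L u = nseq a u ++ nseq M u ++ nseq b u.
  by rewrite -!nseqD; congr nseq; rewrite /a /M /b; lia.
rewrite !rect_cat !size_nseq.
have -> : c + a%:Z = k by rewrite /a; lia.
have yE : y = level k K M by rewrite /level /M; lia.
have [g1 dg1 [in1 out1]] := @absorb_right _ k y (rect (k + M%:Z) K (nseq b u)) g
  ltac:(by apply: (@all_rect _ _ _ _ (fun d => y < d)) => d; rewrite yE /level; lia) dg.
have [g2 dg2 [in2 out2]] := @absorb_left _ k y (rect c K (nseq a u))
  (rect k K (nseq M u)) g1
  ltac:(by apply: (@all_rect _ _ _ _ (fun d => d < k)) => d; rewrite size_nseq /a; lia) dg1.
have {}in1 := funext (in1 psi); have {}out1 := funext (out1 psi).
have rc l1 l2 (phi : state -> R) := funext (run_cat l1 l2 phi).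
rewrite !rc in1 out1 -!rc in2 out2 yE in dg2 *.
by have := law_nseq psi u dg2; rewrite /law_in /law_out size_nseq.
Qed.

(** * Chains of heights *)

Definition align (k : int) (p : int * int) : int * int := (k, k + (p.2 - p.1)).

Section Chains.
Variables (X : Type) (F : seq (int * int) -> X).
Hypothesis F_hook : forall (k y : int) (al : seq (int * int)) (ts : seq nat),
  all (fun p : int * int => (p.1 <= k) && (y <= p.2)) al ->
  F (al ++ [seq (k + i%:Z, y) | i : nat <- ts]) =
  F (al ++ [seq (k, y - i%:Z) | i : nat <- ts]).

Definition crosses (p q : int * int) := (p.1 <= q.1) && (q.2 <= p.2).

(* Turns the tail of a chain around the corner [(k, y)] twice: from a vertical
   to a horizontal line and, with a smaller [k], back to a vertical one. *)
Lemma hook_shift (k k' y : int) (al post : seq (int * int)) : k' <= k ->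
  all (fun p : int * int => (p.1 <= k') && (y <= p.2)) al ->
  all (fun p : int * int => k + (p.2 - p.1) <= y) post ->
  F (al ++ map (align k) post) = F (al ++ map (align k') post).
Proof.
move=> k'k al_k' post_y.
have al_k : all (fun p : int * int => (p.1 <= k) && (y <= p.2)) al.
  by apply: sub_all al_k' => p; lia.
transitivity (F (al ++ [seq (k, y - i%:Z) | i : nat <-
    [seq absz (y - k - (p.2 - p.1))%R | p <- post]])).
  congr (F (_ ++ _)); rewrite -map_comp; apply/eq_in_map => p.
  move=> /(allP post_y) py; rewrite /align /=; congr (_, _); lia.
rewrite -F_hook//.
transitivity (F (al ++ [seq (k' + i%:Z, y) | i : nat <-
    [seq absz (y - k' - (p.2 - p.1))%R | p <- post]])).
  congr (F (_ ++ _)); rewrite -!map_comp; apply/eq_in_map => p.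
  move=> /(allP post_y) py /=; congr (_, _); lia.
rewrite F_hook//; congr (F (_ ++ _)); rewrite -map_comp; apply/eq_in_map => p.
move=> /(allP post_y) py; rewrite /align /=; congr (_, _); lia.
Qed.

(** Points are aligned starting from the last. The aligned tail [post] is brought to the color of
    the last remaining point [p] by turning around [p], which then joins it; a last turn, around
    [(k0, y0)], brings everything to [k0]. *)
Lemma chain_align (s : seq (int * int)) (k0 y0 : int) :
  pairwise crosses s -> all (fun p : int * int => (k0 <= p.1) && (p.2 <= y0)) s ->
  F s = F (map (align k0) s).
Proof.
suff gen (pre post : seq (int * int)) (k : int) : pairwise crosses pre ->
    all (fun p : int * int => (k0 <= p.1) && (p.2 <= y0)) pre -> k0 <= k ->
    all (fun q : int * int => k + (q.2 - q.1) <= y0) post ->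
    all (fun p : int * int => (p.1 <= k) &&
       all (fun q : int * int => k + (q.2 - q.1) <= p.2) post) pre ->
    F (pre ++ map (align k) post) = F (map (align k0) (pre ++ post)).
  (* The tail is empty at first, with a color above all those of [s]. *)
  move=> cs bs; have := gen s [::] (foldr Num.max k0 (map fst s)) cs bs.
  rewrite !cats0 => -> //.
    by elim: (s) => //= p r IH; rewrite le_max IH orbT.
  apply/allP => p ps; rewrite andbT.
  elim: (s) ps => //= q r IH; rewrite inE le_max => /orP[/eqP->|/IH ->].
    by rewrite lexx.
  by rewrite orbT.
elim/last_ind: pre post k => [|pre p IH] post k.
  move=> _ _ kk posty _; exact: (@hook_shift k k0 y0 [::]).
rewrite pairwise_rcons all_rcons => /andP[prep cpre].
rewrite all_rcons => /andP[/andP[kp py] bpre] kk posty /andP[/andP[pk pyq] ball].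
rewrite (@hook_shift k p.1 p.2)//; last first.
  rewrite all_rcons !lexx /=; exact: prep.
have -> : rcons pre p ++ map (align p.1) post =
    pre ++ map (align p.1) (p :: post).
  by rewrite cat_rcons /= {2}/align addrC subrK; case: (p).
rewrite IH ?cat_rcons//.
- rewrite /= addrC subrK py /=; apply: sub_all posty => q; lia.
- apply/allP => q qpre /=; have := allP prep _ qpre; rewrite /crosses => /andP[-> h].
  rewrite [p.1 + _]addrC subrK h /=.
  have /andP[_ ] := allP ball _ qpre; apply: sub_all => r; lia.
Qed.

End Chains.

(** * Independent clocks *)

Lemma measurable_all d (T : measurableType d) (I : Type) (l : seq I)
    (f : I -> T -> bool) :
  (forall i, measurable [set w | f i w]) ->
  measurable [set w | all (f^~ w) l].
Proof.
move=> mf; elim: l => [|i l IH] /=.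
  by rewrite (_ : [set w | _] = setT)//; apply/seteqP; split.
rewrite (_ : [set w | _] = [set w | f i w] `&` [set w | all (f^~ w) l]).
  exact: measurableI.
by apply/seteqP; split=> w /= => [/andP|[? ?]]; [|apply/andP].
Qed.

Lemma measurable_eqb d (T : measurableType d) (f : T -> bool) b :
  measurable [set w | f w] -> measurable [set w | f w == b].
Proof.
case: b => mf; first by under eq_set do rewrite eqb_id.
rewrite (_ : [set w | _] = ~` [set w | f w]); first exact: measurableC.
by apply/seteqP; split=> w /=; rewrite eqbF_neg => /negP.
Qed.

Section RandomWords.
Context (d : measure_display) (T : measurableType d) (R : realType).
Variable P : probability T R.
Variables (I : eqType) (silent : I -> T -> bool) (cut : I -> int) (q : R).
Hypothesis measurable_silent : forall i, measurable [set w | silent i w].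
Hypothesis silent_independent : forall (l : seq I) (b : I -> bool), uniq l ->
  P [set w | all (fun i => silent i w == b i) l] =
  (\prod_(i <- l) (if b i then q else 1 - q))%:E.

Fixpoint exec (w : T) (l : seq I) (H : state) : state :=
  if l is i :: l' then exec w l' (if silent i w then H else swap_pos (cut i) H)
  else H.

Lemma measurable_exec l H (p : pred state) : measurable [set w | p (exec w l H)].
Proof.
elim: l H => [|i l IH] H /=.
  case: (p H); last by rewrite (_ : [set w | _] = set0)//; apply/seteqP; split.
  by rewrite (_ : [set w | _] = setT)//; apply/seteqP; split.
rewrite (_ : [set w | _] = [set w | silent i w] `&` [set w | p (exec w l H)] `|`
  ~` [set w | silent i w] `&` [set w | p (exec w l (swap_pos (cut i) H))]).
  apply: measurableU; apply: measurableI => //; exact: measurableC.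
apply/seteqP; split=> w /=; case: (silent i w) => /= h; [by left|by right| |].
  by case: h => -[].
by case: h => -[].
Qed.

Lemma prob_exec l H (p : pred state) : uniq l ->
  P [set w | p (exec w l H)] =
  (run [seq cell (cut i) q | i <- l] (fun G => (p G)%:R) H)%:E.
Proof.
(* Independence is stated for conjunctions of outcomes, so those of the letters already read are
   carried along in [l1]. *)
suff gen l1 b : uniq (l1 ++ l) ->
    P [set w | all (fun i => silent i w == b i) l1 && p (exec w l H)] =
    ((\prod_(i <- l1) (if b i then q else 1 - q)) *
     run [seq cell (cut i) q | i <- l] (fun G => (p G)%:R) H)%:E.
  by move=> ul; have := gen [::] xpredT ul; rewrite /= big_nil mul1r.
elim: l H l1 b => [|i l IH] H l1 b /=.
  rewrite cats0 => ul1; case: (p H); last first.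
    rewrite mulr0 (_ : [set w | _] = set0) ?measure0//.
    by apply/seteqP; split=> w //=; rewrite andbF.
  by rewrite mulr1 -silent_independent//; congr (P _);
     apply/seteqP; split=> w /=; rewrite andbT.
move=> ul; have il1 : i \notin l1.
  by move: ul; rewrite cat_uniq /= negb_or => /and3P[_ /andP[]].
have ul' : uniq (rcons l1 i ++ l) by rewrite cat_rcons.
pose ev c := [set w | all (fun j => silent j w == (if j == i then c else b j))
   (rcons l1 i) && p (exec w l (if c then H else swap_pos (cut i) H))].
have evE c w : ev c w <-> (silent i w = c) /\
    all (fun j => silent j w == b j) l1 &&
    p (exec w l (if c then H else swap_pos (cut i) H)).
  rewrite /ev /= all_rcons eqxx -andbA.
  have -> : all (fun j => silent j w == (if j == i then c else b j)) l1 =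
      all (fun j => silent j w == b j) l1.
    by apply: eq_in_all => j /(memPn il1) /negPf->.
  by split=> [/andP[/eqP-> ->]|[-> ->]]; rewrite ?eqxx.
have mev c : measurable (ev c).
  rewrite (_ : ev c = [set w | all (fun j => silent j w ==
     (if j == i then c else b j)) (rcons l1 i)] `&`
     [set w | p (exec w l (if c then H else swap_pos (cut i) H))]).
    apply: measurableI; last exact: measurable_exec.
    apply: (@measurable_all _ _ _ _
      (fun j w => silent j w == (if j == i then c else b j))) => j.
    exact: measurable_eqb.
  by apply/seteqP; split=> w /= => [/andP|[? ?]]; [|apply/andP].
rewrite (_ : [set w | _] = ev true `|` ev false); last first.
  apply/seteqP; split=> w /=.
    by case e: (silent i w) => h; [left|right]; apply/evE.
  by move=> [|] /evE [-> ->].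
rewrite measureU//; last first.
  by apply/seteqP; split=> w //= [/evE[e1 _] /evE[]]; rewrite e1.
have wE c : \prod_(j <- l1) (if (if j == i then c else b j) then q else 1 - q) =
    \prod_(j <- l1) (if b j then q else 1 - q).
  by apply: eq_big_seq => j /(memPn il1) /negPf->.
have Pev c := IH (if c then H else swap_pos (cut i) H) (rcons l1 i)
  (fun j => if j == i then c else b j) ul'.
rewrite [X in (X + _)%E](Pev true) [X in (_ + X)%E](Pev false) -EFinD.
by congr (_%:E); rewrite !big_rcons /= !eqxx !wE /=; ring.
Qed.

End RandomWords.

Section PoissonCells.
Context (d : measure_display) (T : measurableType d) (R : realType).
Variables (P : probability T R) (N : int -> R -> T -> nat) (delta : R).
Hypothesis clocks : poisson_clocks P N.
Hypothesis delta0 : 0 <= delta.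

(* [i = (e, m)] stands for the time slot [m] of the clock of the edge [e]. *)
Definition silent (i : int * nat) (w : T) : bool :=
  N i.1 (delta * i.2.+1%:R) w == N i.1 (delta * i.2%:R) w.

Let time0 m : 0 <= delta * m%:R. Proof. by rewrite mulr_ge0. Qed.

Let timeS m : delta * m%:R <= delta * m.+1%:R.
Proof. by rewrite ler_wpM2l// ler_nat. Qed.

Lemma measurable_silent i : measurable [set w | silent i w].
Proof.
have [hN _] := clocks.
have mN m := poisson_process_measurable (hN i.1) (time0 m).
have := measurable_fun_eqn (mN i.2.+1) (mN i.2) measurableT (Y := [set true]).
by rewrite setTI; apply.
Qed.

Lemma measurable_silent_clock e m :
  process_sigma_algebra (N e) [set w | silent (e, m) w].
Proof.
pose G := \bigcup_(t in [set t | 0 <= t]) preimage_set_system setT (N e t) measurable.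
have mN n : measurable_fun (setT : set (g_sigma_algebraType G)) (N e (delta * n%:R)).
  move=> _ Y mY; apply: sub_sigma_algebra.
  by exists (delta * n%:R); [exact: time0|exists Y].
have := measurable_fun_eqn (mN m.+1) (mN m) measurableT (Y := [set true]).
by rewrite setTI; apply.
Qed.

Lemma silent_increment i w :
  silent i w = ((N i.1 (delta * i.2.+1%:R) w - N i.1 (delta * i.2%:R) w)%N == 0%N).
Proof.
have [hN _] := clocks.
have := poisson_process_nondecreasing (hN i.1) w (time0 i.2) (timeS i.2).
by rewrite /silent subn_eq0; lia.
Qed.

Lemma prob_silent i : P [set w | silent i w] = (expR (- delta))%:E.
Proof.
have [hN _] := clocks; have [d0|d0] := eqVneq delta 0.
  rewrite d0 oppr0 expR0 (_ : [set w | _] = setT) ?probability_setT//.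
  by apply/seteqP; split=> w //= _; rewrite /silent d0 !mul0r.
have dpos : 0 < delta by rewrite lt_neqAle eq_sym d0.
have lt : delta * i.2%:R < delta * i.2.+1%:R by rewrite ltr_pM2l// ltr_nat.
have := poisson_process_increment_law (hN i.1) 0%N (time0 i.2) lt.
have -> : delta * i.2.+1%:R - delta * i.2%:R = delta by rewrite -natr1; ring.
rewrite /poisson_pmf dpos expr0 fact0 invr1 !mul1r => <-; congr (P _).
apply/seteqP; split=> w /=; rewrite silent_increment; first by move/eqP.
by move=> ->.
Qed.

Definition weight (b : bool) : R :=
  if b then expR (- delta) else 1 - expR (- delta).

Lemma prob_silent_eq i b : P [set w | silent i w == b] = (weight b)%:E.
Proof.
case: b; rewrite /weight.
  by rewrite -(prob_silent i); under eq_set do rewrite eqb_id.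
rewrite EFinB -(prob_silent i) -probability_setC; last exact: measurable_silent.
by congr (P _); apply/seteqP; split=> w /=; rewrite eqbF_neg => /negP.
Qed.

Lemma prob_silent_clock e (ms : seq nat) (b : nat -> bool) : uniq ms ->
  P [set w | all (fun m => silent (e, m) w == b m) ms] =
  (\prod_(m <- ms) weight (b m))%:E.
Proof.
move=> ums; have [hN _] := clocks.
have := poisson_process_independent_increments (hN e) (t := fun m => delta * m%:R)
  (time0 0) timeS.
move=> /(_ [fset m in ms]%fset (fun m => [set w | silent (e, m) w == b m])).
have E : perm_eq [fset m in ms]%fset ms.
  by apply: uniq_perm => // m; rewrite !inE.
rewrite (perm_big _ E) /= => ind.
rewrite -(prodEFin) (_ : [set w | _] =
  \bigcap_(m in [set` [fset m in ms]%fset]) [set w | silent (e, m) w == b m]).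
  rewrite ind; first by apply: eq_bigr => m _; rewrite prob_silent_eq.
  move=> m _; exists [set n : nat | (n == 0%N) == b m] => //.
  by rewrite setTI; apply/seteqP; split=> w /=; rewrite silent_increment.
apply/seteqP; split=> w /=.
  by move=> /allP h m /=; rewrite !inE; apply: h.
by move=> h; apply/allP => m mms; apply: h; rewrite /= !inE.
Qed.

(** Slots are grouped by edge: independence of the clocks separates the edges, independence of
    increments the slots of one edge. *)
Lemma silent_independent (l : seq (int * nat)) (b : int * nat -> bool) : uniq l ->
  P [set w | all (fun i => silent i w == b i) l] =
  (\prod_(i <- l) weight (b i))%:E.
Proof.
move=> ul; have [_ ind] := clocks.
pose J := undup [seq i.1 | i <- l].
pose E e := [set w | all (fun m => silent (e, m) w == b (e, m))
  [seq i.2 | i <- l & i.1 == e]].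
have PE e : P (E e) = (\prod_(i <- l | i.1 == e) weight (b i))%:E.
  rewrite /E prob_silent_clock; last first.
    rewrite map_inj_in_uniq ?filter_uniq// => -[e1 m1] [e2 m2].
    by rewrite !mem_filter /= => /andP[/eqP-> _] /andP[/eqP-> _] ->.
  rewrite big_map big_filter; congr (_%:E); apply: eq_bigr => -[e' m] /=.
  by move=> /eqP->.
have := ind [fset e in J]%fset E.
have pJ : perm_eq [fset e in J]%fset J.
  by apply: uniq_perm => //; [exact: undup_uniq|move=> e; rewrite !inE].
rewrite (perm_big _ pJ) /= => {}ind.
rewrite (_ : [set w | _] = \bigcap_(e in [set` [fset e in J]%fset]) E e).
  rewrite ind; last first.
    move=> e _.
    pose G := \bigcup_(t in [set t | 0 <= t]) preimage_set_system setT (N e t) measurable.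
    apply: (@measurable_all _ (g_sigma_algebraType G) _ _
      (fun m w => silent (e, m) w == b (e, m))) => m.
    by apply: measurable_eqb; exact: measurable_silent_clock.
  under eq_bigr do rewrite PE.
  rewrite prodEFin; congr (_%:E).
  have uJ : uniq J by exact: undup_uniq.
  have lJ : all (fun i => i.1 \in J) l.
    by apply/allP => i il; rewrite mem_undup; apply/mapP; exists i.
  elim: (l) lJ => [|i l' IH] /=; first by rewrite big_nil big1// => e _; rewrite big_nil.
  move=> /andP[iJ l'J]; rewrite big_cons -IH//.
  rewrite [RHS](_ : _ = \prod_(e <- J) ((if i.1 == e then weight (b i) else 1) *
     \prod_(j <- l' | j.1 == e) weight (b j))).
    by apply: eq_bigr => e _; rewrite big_cons; case: eqP => _; rewrite ?mul1r.
  rewrite big_split /=; congr (_ * _).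
  rewrite -big_mkcond /= (big_rem i.1)//= eqxx big1_seq ?mulr1// => e.
  by rewrite mem_rem_uniq// inE => /andP[/eqP->]; rewrite eqxx.
apply/seteqP; split=> w /=.
  move=> /allP h e /= _; apply/allP => m /mapP[[e' m']].
  by rewrite mem_filter => /andP[/eqP/= -> il] ->; apply: h.
move=> h; apply/allP => -[e m] il.
have /= := h e; rewrite !inE mem_undup => /(_ _)/allP; apply.
  by apply/mapP; exists (e, m).
by apply/mapP; exists (e, m) => //; rewrite mem_filter eqxx.
Qed.

End PoissonCells.

(** * Trajectories *)

(** Induction along a real interval, suited to trajectories described only by their right and left
    neighborhoods: the supremum of the times up to which [Q] holds must be [b]. *)
Lemma real_induction (R : realType) (a b : R) (Q : R -> Prop) : a <= b -> Q a ->
  (forall s, a <= s -> s < b -> Q s -> \forall s' \near s^'+, Q s') ->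
  (forall s, a < s -> s <= b -> (forall s', a <= s' -> s' < s -> Q s') -> Q s) ->
  Q b.
Proof.
move=> ab Qa right left.
pose S := [set x | a <= x <= b /\ forall s, a <= s -> s <= x -> Q s].
have Sa : S a.
  split; first by rewrite lexx.
  by move=> s s1 s2; have -> : s = a by apply/eqP; rewrite eq_le s1 s2.
have bS : has_ubound S by exists b => x [/andP[]].
have ac : a <= sup S := ub_le_sup bS Sa.
have cb : sup S <= b by apply: ge_sup; [exists a|move=> x [/andP[]]].
have below s : a <= s -> s < sup S -> Q s.
  move=> as_ sc; have e0 : 0 < sup S - s by rewrite subr_gt0.
  have [x [_ Qx] sx] := sup_adherent e0 (conj (ex_intro _ a Sa) bS).
  by apply: Qx => //; apply: ltW; rewrite subKr in sx.
have Qc : Q (sup S).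
  by have [<-//|ne] := eqVneq a (sup S); apply: left => //; rewrite lt_neqAle ne.
have [<-//|ne] := eqVneq (sup S) b.
have {ne}cb' : sup S < b by rewrite lt_neqAle ne.
have /nbhs_ballP[e /= e0 He] := right _ ac cb' Qc.
suff : S (Num.min (sup S + e / 2) b).
  move=> /(ub_le_sup bS); rewrite ge_min => /orP[|]; last by lra.
  by rewrite gerDl leNgt divr_gt0.
split=> [|s as_]; rewrite ?le_min ?ge_min ?lexx ?orbT.
  by rewrite ab !andbT; apply: le_trans ac _; rewrite lerDl divr_ge0// ltW.
move=> /andP[se _]; have [sc|] := ltP s (sup S); first exact: below.
rewrite le_eqVlt => /orP[/eqP<-//|cs]; apply: He => //=.
rewrite /ball /= distrC ger0_norm; last by lra.
by lra.
Qed.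

Lemma near_ints (U : Type) (F : set_system U) (A : int -> set U) (lo hi : int) :
  Filter F -> (forall x, lo < x <= hi -> \forall s \near F, A x s) ->
  \forall s \near F, forall x, lo < x <= hi -> A x s.
Proof.
move=> FF; have [|hl] := leP lo hi; last first.
  by move=> _; apply: nearW => s x; lia.
move=> lh; rewrite (_ : hi = lo + (absz (hi - lo))%:Z); last by lia.
elim: (absz _) => [|n IH] h; first by apply: nearW => s x; lia.
have := IH (fun x hx => h x ltac:(lia)); have := h (lo + n.+1%:Z) ltac:(lia).
apply: filterS2 => s h1 h2 x hx.
have [->//|ne] := eqVneq x (lo + n.+1%:Z).
by apply: h2; move: hx => /andP[h3 h4]; apply/andP; split => //; move/eqP: ne; lia.
Qed.

Lemma near_left_ex (R : realType) (x : R) (A : set R) :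
  (\forall s \near x^'-, A s) -> exists s, A s.
Proof. by move=> Ax; apply: (@filter_ex _ _ (at_left_proper_filter x)). Qed.

Section Trajectories.
Variables (R : realType) (N : int -> R -> nat) (z : R -> int -> int).
Implicit Types (e x k y lo hi : int) (s t a b : R).
Hypothesis N_le : forall e s t, 0 <= s -> s <= t -> (N e s <= N e t)%N.
Hypothesis N_right : forall e t, 0 <= t -> \forall s \near t^'+, N e s = N e t.
Hypothesis z_path : colored_TASEP_path (fun e => rings (N e)) z.

Lemma z_right t x : 0 <= t -> \forall s \near t^'+, z s x = z t x.
Proof. by have [_ + _] := z_path; apply. Qed.

Lemma no_ring e a b s : 0 <= a -> N e b = N e a -> a < s -> s <= b ->
  ~ rings (N e) s.
Proof.
move=> a0 Nab as_ sb [_ /(_ a a0 as_)]; rewrite -Nab ltnNge N_le//.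
by apply: le_trans a0 (ltW as_).
Qed.

Lemma silent_sub e a b a' b' : 0 <= a -> a <= a' -> a' <= b' -> b' <= b ->
  N e b = N e a -> N e b' = N e a'.
Proof.
move=> a0 aa' ab' bb' e0; have a'0 := le_trans a0 aa'.
have := N_le e a0 aa'; have := N_le e a'0 ab'.
have := N_le e (le_trans a'0 ab') bb'; lia.
Qed.

(** No color crosses a silent edge, so the sites of the block only exchange colors among
    themselves. *)
Lemma silent_block e1 e2 t : 0 <= t -> N e1 t = N e1 0 -> N e2 t = N e2 0 ->
  forall x, e1 < x <= e2 -> e1 < z t x <= e2.
Proof.
move=> t0 Ne1 Ne2.
apply: (@real_induction _ 0 t (fun s => forall x, e1 < x <= e2 -> e1 < z s x <= e2)) => //.
- by have [z0 _ _] := z_path; move=> x; rewrite z0.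
- move=> s s0 st Qs.
  have : \forall s' \near s^'+, forall x, e1 < x <= e2 -> z s' x = z s x.
    by apply: near_ints => x _; apply: z_right.
  by apply: filterS => s' h x hx; rewrite h//; apply: Qs.
move=> s s0 st Qlt x hx; have [_ _ /(_ s s0)[zm [zl zr zq]]] := z_path.
have zmQ y : e1 < y <= e2 -> e1 < zm y <= e2.
  move=> hy; have h1 := nbhs_left_gt s0; have h2 := nbhs_left_lt s.
  have [s' [[h3 h4] h5]] := near_left_ex (filterI (filterI (zl y) h1) h2).
  by rewrite -h3; apply: Qlt => //; apply: ltW.
have nr1 := no_ring (lexx 0) Ne1 s0 st; have nr2 := no_ring (lexx 0) Ne2 s0 st.
have [rx|nrx] := pselect (rings (N x) s).
  have xe2 : x != e2 by apply: contra_notN nr2 => /eqP<-.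
  have hx1 : e1 < x + 1 <= e2 by lia.
  by have := zr x rx; case: ifP => _ [-> _]; apply: zmQ.
have [rx|nrx'] := pselect (rings (N (x - 1)) s); last by rewrite zq//; apply: zmQ.
have xe1 : x - 1 != e1 by apply: contra_notN nr1 => /eqP<-.
have hx1 : e1 < x - 1 <= e2 by lia.
by have := zr _ rx; rewrite subrK; case: ifP => _ [_ ->]; apply: zmQ.
Qed.

Lemma site_silent x a b : 0 <= a -> a <= b ->
  N (x - 1) b = N (x - 1) a -> N x b = N x a -> z b x = z a x.
Proof.
move=> a0 ab N1 N2.
apply: (@real_induction _ a b (fun s => z s x = z a x)) => //.
  move=> s as_ sb <-; apply: z_right; exact: le_trans as_.
move=> s as_ sb Qlt; have s0 : 0 < s by apply: le_lt_trans as_.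
have [_ _ /(_ s s0)[zm [zl _ zq]]] := z_path.
rewrite zq; [|exact: (no_ring a0 N1)|exact: (no_ring a0 N2)].
have [s' [[h3 h4] h5]] := near_left_ex (filterI (filterI (zl x) (nbhs_left_gt as_))
  (nbhs_left_lt s)).
by rewrite -h3; apply: Qlt => //; apply: ltW.
Qed.

(** The first ring sorts the two sites, and later rings find them sorted; the silent neighbors bring
    in no other color. *)
Lemma edge_active e a b : 0 <= a -> a <= b ->
  N (e - 1) b = N (e - 1) a -> N (e + 1) b = N (e + 1) a -> N e b <> N e a ->
  z b e = Num.max (z a e) (z a (e + 1)) /\
  z b (e + 1) = Num.min (z a e) (z a (e + 1)).
Proof.
move=> a0 ab N1 N2 Nab.
pose Q s := if N e s == N e a then z s e = z a e /\ z s (e + 1) = z a (e + 1) else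
  z s e = Num.max (z a e) (z a (e + 1)) /\
  z s (e + 1) = Num.min (z a e) (z a (e + 1)).
suff : Q b by rewrite /Q; case: eqP.
apply: (@real_induction _ a b Q) => //; first by rewrite /Q eqxx.
  move=> s as_ sb Qs; have s0 : 0 <= s by exact: le_trans as_.
  move: (z_right e s0) (z_right (e + 1) s0) (N_right e s0); apply: filterS3.
  by move=> s' h1 h2 h3; rewrite /Q h1 h2 h3.
move=> s as_ sb Qlt; have s0 : 0 < s by apply: le_lt_trans as_.
have [_ _ /(_ s s0)[zm [zl zr zq]]] := z_path.
have near_s : nbhs s^'- (([set s' | z s' e = zm e] `&`
    [set s' | z s' (e + 1) = zm (e + 1)]) `&` ([set s' | a < s'] `&` [set s' | s' < s])).
  apply: filterI; apply: filterI; [exact: zl|exact: zl|exact: nbhs_left_gt|].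
  exact: nbhs_left_lt.
have [re|nre] := pselect (rings (N e) s).
  have [s' [[h1 h2] [h3 h4]]] := near_left_ex near_s.
  have := Qlt s' (ltW h3) h4; rewrite /Q h1 h2.
  have -> : (N e s == N e a) = false.
    by have [_ /(_ a a0 as_)] := re; lia.
  have := zr e re; case: ifP => h [-> ->]; case: ifP => _ [e1 e2];
    move: h; rewrite e1 e2; case: (ltP (z a e) (z a (e + 1))); lia.
(* By definition of [rings], when [s] is not a ring the counter is constant on some interval from
   [s1] to [s], so its value just before [s] is its value at [s]. *)
have [s1 [s10 s1s Ns1]] : exists s1, [/\ 0 <= s1, s1 < s & (N e s <= N e s1)%N].
  apply: contrapT => h; apply: nre; split=> // s1 s10 s1s.
  by rewrite ltnNge; apply/negP => h1; apply: h; exists s1.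
have [s' [[[h1 h2] [h3 h4]] h5]] := near_left_ex (filterI near_s (nbhs_left_gt s1s)).
have Ns' : N e s' = N e s.
  have := N_le e s10 (ltW h5); have := N_le e (le_trans s10 (ltW h5)) (ltW h4).
  by move: Ns1; lia.
have := Qlt s' (ltW h3) h4; rewrite /Q Ns' h1 h2 zq//; last first.
  exact: (no_ring a0 N1).
rewrite (zq (e + 1)) ?addrK//; exact: (no_ring a0 N2).
Qed.

(** The height counted from a finite left end; it is the true one when the colors left of [lo] are
    below [lo] and [lo <= k]. *)
Definition hcount (lo : int) (zeta : int -> int) (k y : int) : nat :=
  count (fun i : nat => k <= zeta (lo + i%:Z)) (iota 0 (absz (y - lo)%R)).

Lemma hcountS lo zeta k y : lo <= y ->
  hcount lo zeta k (y + 1) = (hcount lo zeta k y + (k <= zeta y)%R)%N.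
Proof.
move=> loy; rewrite /hcount.
have -> : absz (y + 1 - lo)%R = (absz (y - lo)%R).+1 by lia.
rewrite -addn1 iotaD count_cat /= addn0 add0n.
by have -> : lo + (absz (y - lo))%:Z = y by lia.
Qed.

Lemma hcount0 lo zeta k : hcount lo zeta k lo = 0%N.
Proof. by rewrite /hcount subrr. Qed.

Section Slot.
Variables (lo hi : int) (a b : R).
Hypotheses (a0 : 0 <= a) (ab : a <= b).
Let sil e := N e b == N e a.
Hypothesis sil_lo : sil (lo - 1).
Hypothesis no_adjacent : forall e, lo <= e + 1 -> e + 1 < hi -> sil e || sil (e + 1).

(** The edge [y - 1] straddles the cut [y]. If the edge [y - 2] is silent too, the site [y - 1]
    keeps its color; otherwise the sites [y - 2] and [y - 1] are only permuted, and the claim at the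
    cut [y - 2] applies. *)
Lemma hcount_silent k y : lo <= y -> y <= hi -> sil (y - 1) ->
  hcount lo (z b) k y = hcount lo (z a) k y.
Proof.
move=> loy; rewrite (_ : y = lo + (absz (y - lo))%:Z); last by lia.
have [n] := ubnP (absz (y - lo)); elim: n (absz _) => // n IH [|m].
  by rewrite addr0 !hcount0.
rewrite ltnS => mn.
have -> : lo + m.+1%:Z = lo + m%:Z + 1 by lia.
set x := lo + m%:Z; rewrite addrK => xhi silx.
rewrite !hcountS; [|rewrite /x; lia..].
have [s1|/negP s1] := boolP (sil (x - 1)).
  rewrite (@site_silent x a b)// ?(eqP s1) ?(eqP silx)//.
  by rewrite IH//; rewrite /x in xhi *; lia.
case: m mn @x xhi silx s1 => [|m] mn x xhi silx s1.
  by exfalso; apply: s1; rewrite /x addr0.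
have xE : x = lo + m%:Z + 1 by rewrite /x; lia.
rewrite xE addrK in s1 *.
have s2 : sil (lo + m%:Z - 1).
  have := @no_adjacent (lo + m%:Z - 1) ltac:(lia) ltac:(rewrite xE in xhi; lia).
  by rewrite subrK => /orP[].
have [e1 e2] := @edge_active (lo + m%:Z) a b a0 ab (eqP s2) ltac:(by rewrite -xE; apply/eqP)
  ltac:(by apply/eqP/negP).
rewrite !hcountS ?e1 ?e2; [|lia..].
rewrite IH; [lia|lia|rewrite xE in xhi; lia|exact: s2].
Qed.

Lemma hcount_active k y : lo <= y -> y < hi -> ~~ sil (y - 1) ->
  hcount lo (z b) k y =
  minn (hcount lo (z a) k (y - 1)).+1 (hcount lo (z a) k (y + 1)).
Proof.
move=> loy yhi act.
have lo1 : lo <= y - 1.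
  have : y != lo by apply: contraNneq act => ->.
  lia.
have s2 : sil (y - 1 - 1).
  have := @no_adjacent (y - 1 - 1) ltac:(lia) ltac:(lia).
  by rewrite subrK (negPf act) orbF.
have s1 : sil y.
  have := @no_adjacent (y - 1) ltac:(lia) ltac:(lia).
  by rewrite subrK (negPf act).
have [e1 e2] := @edge_active (y - 1) a b a0 ab (eqP s2)
  ltac:(by rewrite subrK; apply/eqP) ltac:(by apply/eqP).
rewrite subrK in e1 e2.
have hb := hcountS (z b) k lo1; have ha := hcountS (z a) k lo1; rewrite subrK in ha hb.
rewrite hb hcountS// ha e1 hcount_silent//; last by lia.
lia.
Qed.

End Slot.

End Trajectories.

(** * Coupling of the discrete model with the TASEP *)

Fixpoint cells (c : int) (L m K : nat) : seq (int * nat) :=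
  if K is K'.+1 then
    [seq (e, m) | e <- [seq c + i%:Z - 1 | i : nat <- iota 0 L]] ++
    cells (c - 1) L m.+1 K'
  else [::].

Lemma uniq_cells c L m K : uniq (cells c L m K).
Proof.
suff h : uniq (cells c L m K) && all (fun i => (m <= i.2)%N) (cells c L m K).
  by case/andP: h.
elim: K c m => [|K IH] c m //=; have /andP[u a] := IH (c - 1) m.+1.
rewrite cat_uniq u andbT all_cat -map_comp map_inj_uniq ?iota_uniq /=; last first.
  by move=> i j [] /addIr/addrI [].
apply/andP; split.
  apply/hasPn => i /(allP a) mi; apply/negP => /mapP[j _ e].
  by rewrite e ltnn in mi.
apply/andP; split; first by apply/allP => _ /mapP[i _ ->] /=.
by apply: sub_all a => i /ltnW.
Qed.

(** The edge [e] acts at the cut [e + 1], so the slots give rows starting at the cuts [c], [c - 1],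
    and so on. *)
Lemma rows_cells (A : comPzRingType) (u : A) c L m K :
  [seq cell (i.1 + 1) u | i <- cells c L m K] = rows_word c K (nseq L u).
Proof.
elim: K c m => [|K IH] c m //=; rewrite map_cat IH; congr (_ ++ _).
rewrite -!map_comp; elim: L c {IH} => [|L IHL] c //=.
rewrite addr0 subrK -IHL; congr (_ :: _).
rewrite -[1%N]/(1 + 0)%N iotaDl -map_comp; apply: eq_map => i /=.
by congr cell; lia.
Qed.

Lemma exec_cat d (T : measurableType d) (I : eqType) (sil : I -> T -> bool) (cut : I -> int) w l1 l2 H :
  exec sil cut w (l1 ++ l2) H = exec sil cut w l2 (exec sil cut w l1 H).
Proof. by elim: l1 H => //= i l IH H; rewrite IH. Qed.

(** An active cut reads only its two neighbors, whose edges are silent, so updating from left to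
    right amounts to updating all at once. *)
Lemma exec_row d (T : measurableType d) (sil : int * nat -> T -> bool) w m (lo hi : int) (es : seq int) H :
  uniq es -> sil (lo - 1, m) w -> sil (hi - 1, m) w ->
  (forall e, lo <= e + 1 -> e + 1 < hi -> sil (e, m) w || sil (e + 1, m) w) ->
  forall k y, lo <= y <= hi ->
  exec sil (fun i => i.1 + 1) w [seq (e, m) | e <- es] H k y =
  if (y - 1 \in es) && ~~ sil (y - 1, m) w
  then minn (H k (y - 1)).+1 (H k (y + 1)) else H k y.
Proof.
move=> + slo shi nadj k; elim: es H => //= i es IH H /andP[ies ues] y hy.
have nb e : ~~ sil (e, m) w -> lo <= e + 1 <= hi -> lo < e + 1 < hi.
  move=> se he; have e1 : e != lo - 1 by apply: contraNneq se => ->.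
  have e2 : e != hi - 1 by apply: contraNneq se => ->.
  lia.
rewrite IH// inE; case: (y - 1 =P i) => [yi|/eqP yi] /=.
  rewrite -yi in ies *; rewrite (negPf ies) /=; case: ifP => //= s.
  by rewrite /swap_pos subrK eqxx.
case: ifP => [/andP[yes sy]|_]; last first.
  case: ifP => // _; rewrite /swap_pos; have -> : (y == i + 1) = false by lia.
  by [].
case: ifP => // si; have hy' := nb _ sy ltac:(rewrite subrK).
rewrite subrK in hy'.
have s1 : sil (y - 1 - 1, m) w.
  by have := nadj (y - 1 - 1); rewrite subrK (negPf sy) orbF; apply; lia.
have s2 : sil (y, m) w.
  by have := nadj (y - 1); rewrite subrK (negPf sy) /=; apply; lia.
rewrite /swap_pos.
have -> : (y - 1 == i + 1) = false.
  apply/eqP => e; have ie : i = y - 1 - 1 by lia.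
  by rewrite ie s1 in si.
have -> : (y + 1 == i + 1) = false; last by [].
apply/eqP => e; have ie : i = y by lia.
by rewrite ie s2 in si.
Qed.

Lemma counting_hcount (R : realType) (zeta : int -> int) (lo k y : int) :
  (forall x, x < lo -> zeta x < lo) -> lo <= k -> lo <= y ->
  counting [set x : int | x < y /\ k <= zeta x] = (hcount lo zeta k y)%:R%:E :> \bar R.
Proof.
move=> low lok loy.
pose s := [seq x <- [seq lo + i%:Z | i : nat <- iota 0 (absz (y - lo))] | k <= zeta x].
have us : uniq s.
  by rewrite filter_uniq// map_inj_uniq ?iota_uniq// => i j /addrI [].
have sE : [set x : int | x < y /\ k <= zeta x] = [set` [fset x in s]%fset].
  apply/seteqP; split=> x /=; rewrite !inE mem_filter.
    move=> [xy kx]; rewrite kx /=; have lox : lo <= x.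
      by rewrite leNgt; apply/negP => /low; lia.
    by apply/mapP; exists (absz (x - lo)); [rewrite mem_iota|]; lia.
  by move=> /andP[kx /mapP[i]]; rewrite mem_iota => hi xE; split=> //; lia.
rewrite /counting asboolT; last by rewrite sE; exact: finite_fset.
congr (_%:R%:E); rewrite sE set_fsetK card_fseq undup_id// size_filter count_map.
exact: eq_count.
Qed.

Section Coupling.
Variables (R : realType) (d : measure_display) (T : measurableType d) (N : int -> R -> T -> nat) (w : T).
Variables (z : R -> int -> int) (delta : R) (lo hi : int).
Implicit Types (e c k y : int) (s t : R) (H : state).
Hypothesis N_le : forall e s t, 0 <= s -> s <= t -> (N e s w <= N e t w)%N.
Hypothesis N_right : forall e t, 0 <= t -> \forall s \near t^'+, N e s w = N e t w.
Hypothesis z_path : colored_TASEP_path (fun e => rings (fun t => N e t w)) z.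
Hypothesis delta0 : 0 <= delta.

Let time m : R := delta * m%:R.
Let time0 m : 0 <= time m. Proof. by rewrite mulr_ge0. Qed.
Let time_le m n : (m <= n)%N -> time m <= time n.
Proof. by move=> mn; rewrite ler_wpM2l// ler_nat. Qed.

Let sil := silent N delta.

(** The first two hypotheses make all [K] rows cover the cuts from [lo] to [hi], although the rows
    drift to the left. *)
Lemma exec_cells c L m K H :
  c <= lo -> hi <= c - K%:Z + L%:Z ->
  (forall n, (m <= n < m + K)%N -> [/\ sil (lo - 1, n) w, sil (hi - 1, n) w &
     forall e, lo <= e + 1 -> e + 1 < hi -> sil (e, n) w || sil (e + 1, n) w]) ->
  (forall k y, lo <= k -> lo <= y <= hi -> H k y = hcount lo (z (time m)) k y) ->
  forall k y, lo <= k -> lo <= y <= hi ->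
    exec sil (fun i => i.1 + 1) w (cells c L m K) H k y =
    hcount lo (z (time (m + K))) k y.
Proof.
elim: K c m H => [|K IH] c m H clo hic ok HE k y lok hy /=.
  by rewrite addn0 HE.
rewrite exec_cat addnS -addSn; apply: IH => //; [lia|lia|by move=> n hn; apply: ok; lia|].
move=> k' y' lok' hy'; have [s1 s2 s3] := ok m ltac:(lia).
rewrite (@exec_row d T sil w m lo hi)//; last first.
  by rewrite map_inj_uniq ?iota_uniq// => i j /addIr/addrI [].
have -> : (y' - 1 \in [seq c + i%:Z - 1 | i : nat <- iota 0 L]) = (c <= y' < c + L%:Z).
  apply/mapP/idP => [[i]|h]; first by rewrite mem_iota; lia.
  by exists (absz (y' - c)); [rewrite mem_iota|]; lia.
have tm := time_le (leqnSn m).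
case: ifP => [/andP[_ act]|h].
  have y'hi : y' < hi.
    have : y' != hi by apply: contraNneq act => ->.
    lia.
  have lo1 : lo < y'.
    have : y' != lo by apply: contraNneq act => ->.
    lia.
  rewrite !HE//; [|lia..].
  rewrite (@hcount_active _ (fun e t => N e t w) z N_le N_right z_path lo hi
    (time m) (time m.+1))//; lia.
rewrite HE// (@hcount_silent _ (fun e t => N e t w) z N_le N_right z_path lo hi
  (time m) (time m.+1))//; [lia|lia|].
apply: contraFT h => act; rewrite act andbT.
have : y' != hi by apply: contraNneq act => ->.
lia.
Qed.

(** A silent edge further left and the silent edge [lo - 1] confine the colors between them, so
    colors from [lo] on are never found left of [lo]. *)
Lemma counting_exec c L K :
  c <= lo -> hi <= c - K%:Z + L%:Z ->
  N (lo - 1) (time K) w = N (lo - 1) 0 w -> N (hi - 1) (time K) w = N (hi - 1) 0 w ->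
  (forall x : int, exists2 e : int, e < x & N e (time K) w = N e 0 w) ->
  (forall n, (n < K)%N ->
     forall e, lo <= e + 1 -> e + 1 < hi -> sil (e, n) w || sil (e + 1, n) w) ->
  forall k y, lo <= k -> lo <= y <= hi ->
    counting [set x : int | x < y /\ k <= z (time K) x] =
    (exec sil (fun i => i.1 + 1) w (cells c L 0 K) packed k y)%:R%:E :> \bar R.
Proof.
move=> clo hic Nlo Nhi left nadj k y lok hy.
have sub e n : N e (time K) w = N e 0 w -> (n < K)%N -> sil (e, n) w.
  move=> Ne nK; apply/eqP.
  exact: (@silent_sub _ (fun e t => N e t w) N_le e 0 (time K) (time n) (time n.+1)
    (lexx 0) (time0 n) (time_le (leqnSn n)) (time_le nK) Ne).
rewrite (@exec_cells c L 0 K)//; last 2 first.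
- by move=> n hn; split; [exact: sub|exact: sub|exact: nadj].
- move=> k' y' lok' /andP[loy' _]; have [z0 _ _] := z_path.
  rewrite /time mulr0 /packed.
  rewrite (_ : y' = lo + (absz (y' - lo))%:Z); last by lia.
  elim: (absz (y' - lo)) => [|n IH]; first by rewrite addr0 hcount0; case: ifP; lia.
  have -> : lo + n.+1%:Z = lo + n%:Z + 1 by lia.
  rewrite hcountS; last by lia.
  by rewrite -IH z0; do 2!case: ifP; lia.
rewrite add0n (@counting_hcount _ _ lo)//; last by case/andP: hy.
move=> x xlo; have [e ex Ne] := left x.
have := @silent_block _ (fun e t => N e t w) z N_le z_path e (lo - 1)
  (time K) (time0 K) Ne Nlo x ltac:(lia).
lia.
Qed.

End Coupling.

(** * Passage to the limit *)

Section Approximation.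
Context (d : measure_display) (T : measurableType d) (R : realType).
Variable P : probability T R.

Lemma le_probability (A B : set T) : measurable A -> measurable B -> A `<=` B ->
  (P A <= P B)%E.
Proof. by move=> mA mB; apply: le_measure; rewrite inE. Qed.

Lemma union_bound (I : Type) (l : seq I) (f : I -> T -> bool) (x : R) :
  (forall i, measurable [set w | f i w]) ->
  (forall i, (P [set w | f i w] <= x%:E)%E) ->
  (P [set w | has (f^~ w) l] <= ((size l)%:R * x)%:E)%E.
Proof.
move=> mf fx.
have mhas s : measurable [set w | has (f^~ w) s].
  rewrite (_ : [set w | _] = ~` [set w | all (fun i => ~~ f i w) s]).
    apply: measurableC; apply: (@measurable_all _ _ _ _ (fun i w => ~~ f i w)) => i.
    by under eq_set do rewrite -eqbF_neg; apply: measurable_eqb.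
  apply/seteqP; split=> w /=; rewrite -[X in ~ is_true X]/(all (predC (f^~ w)) s);
    rewrite all_predC; first by move=> ->.
  by move/negP; rewrite negbK.
elim: l => [|i l IH] /=.
  by rewrite mul0r (_ : [set w | _] = set0) ?measure0//; apply/seteqP; split.
rewrite (_ : [set w | _] = [set w | f i w] `|` [set w | has (f^~ w) l]).
  rewrite (le_trans (measureU2 _ _ _))//.
  rewrite -natr1 mulrDl mul1r addrC EFinD leeD//; exact: fx.
by apply/seteqP; split=> w /=; [move/orP|move=> h; apply/orP].
Qed.

(** Off [B] both events coincide with model events of equal probability, so their probabilities
    differ by at most twice that of [B]. *)
Lemma approx_eq (E1 E2 : set T) : measurable E1 -> measurable E2 ->
  (forall eps : R, 0 < eps -> exists B M1 M2, [/\
     [/\ measurable B, measurable M1 & measurable M2],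
     (P B <= eps%:E)%E, P M1 = P M2 &
     forall w, ~ B w -> (E1 w <-> M1 w) /\ (E2 w <-> M2 w)]) ->
  P E1 = P E2.
Proof.
have half (F1 F2 M1 M2 B : set T) (e : R) : measurable F1 -> measurable F2 ->
    measurable M1 -> measurable M2 -> measurable B ->
    (P B <= (e / 2)%:E)%E -> P M1 = P M2 ->
    (forall w, ~ B w -> (F1 w <-> M1 w) /\ (F2 w <-> M2 w)) ->
    (P F1 <= P F2 + e%:E)%E.
  move=> mF1 mF2 mM1 mM2 mB Be M12 h.
  have h1 : (P F1 <= P M1 + P B)%E.
    apply: le_trans (measureU2 _ mM1 mB); apply: le_probability => //.
      exact: measurableU.
    by move=> w F1w; have [|/h[[+ _] _]] := pselect (B w); [right|left; auto].
  have h2 : (P M2 <= P F2 + P B)%E.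
    apply: le_trans (measureU2 _ mF2 mB); apply: le_probability => //.
      exact: measurableU.
    by move=> w M2w; have [|/h[_ [_ +]]] := pselect (B w); [right|left; auto].
  apply: (le_trans h1); rewrite M12; apply: (le_trans (leeD h2 Be)).
  apply: (le_trans (leeD (leeD (lexx _) Be) (lexx _))).
  by rewrite -addeA -EFinD -splitr.
move=> mE1 mE2 h; apply/eqP; rewrite eq_le; apply/andP; split;
  apply/lee_addgt0Pr => e e0;
  have [B [M1 [M2 [[mB mM1 mM2] Be M12 hB]]]] := h (e / 2) (divr_gt0 e0 (ltr0n _ 2)).
  exact: half mE1 mE2 mM1 mM2 mB Be M12 hB.
apply: half mE2 mE1 mM2 mM1 mB Be (esym M12) _ => w /hB[? ?]; by split.
Qed.

(** There are countably many finite sets of integers, and being equal to one of them is tested site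
    by site; the value [+oo] is the remaining case. *)
Lemma measurable_counting (S : int -> T -> Prop) (c : \bar R) :
  (forall x, measurable [set w | S x w]) ->
  measurable [set w | counting [set x | S x w] = c].
Proof.
move=> mS.
have mF (F : {fset int}) : measurable [set w | [set x | S x w] = [set` F]].
  rewrite (_ : [set w | _] = ~` \bigcup_(x : int)
     (if x \in F then ~` [set w | S x w] else [set w | S x w])).
    apply: measurableC; apply: countable_bigcupT_measurable => // x.
    by case: ifP => _ //; exact: measurableC.
  apply/seteqP; split=> w /=.
    move=> e [x _]; have := congr1 (@^~ x) e; rewrite /=.
    by case: ifP => /= xF Sx; rewrite ?Sx => // ->.
  move=> h; apply/seteqP; split=> x /=.
    by move=> Sx; apply: contrapT => /negP/negbTE xF; apply: h; exists x => //; rewrite xF.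
  by move=> xF; apply: contrapT => Sx; apply: h; exists x => //; rewrite xF.
have mU (D : set {fset int}) :
    measurable (\bigcup_(F in D) [set w | [set x | S x w] = [set` F]]).
  rewrite bigcup_mkcond; apply: countable_bigcupT_measurable => // F.
  by case: ifP => _ //; exact: mF.
rewrite (_ : [set w | _] = \bigcup_(F in [set F : {fset int} | (#|` F|)%:R%:E = c])
    [set w | [set x | S x w] = [set` F]] `|`
  (if c == +oo%E then ~` \bigcup_(F : {fset int}) [set w | [set x | S x w] = [set` F]]
   else set0)).
  apply: measurableU; first exact: mU.
  by case: ifP => _ //; apply: measurableC; exact: mU.
apply/seteqP; split=> w /=.
  rewrite /counting; case: asboolP => [/finite_fsetP[F FE]|nf] <-; last first.
    right; rewrite eqxx => -[F _ FE]; apply: nf; rewrite FE; exact: finite_fset.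
  by left; exists F => //=; rewrite FE set_fsetK.
case=> [[F /= <- FE]|]; first by rewrite /counting FE asboolT ?set_fsetK.
case: eqP => // -> h; rewrite /counting asboolF// => /finite_fsetP[F FE].
by apply: h; exists F.
Qed.

End Approximation.

Lemma cat_eq_take_drop (T : eqType) (s1 s2 v : seq T) :
  (s1 ++ s2 == v) = (s1 == take (size s1) v) && (s2 == drop (size s1) v).
Proof.
have [le|lt] := leqP (size s1) (size v).
  by rewrite -{1}(cat_take_drop (size s1) v) eqseq_cat// size_take_min (minn_idPl le).
rewrite take_oversize ?(ltnW lt)//.
have -> : (s1 == v) = false by apply: contraTF lt => /eqP->; rewrite ltnn.
by apply: contraTF lt => /eqP<-; rewrite -leqNgt size_cat leq_addr.
Qed.

(** * The crucial fact for the TASEP itself *)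

Section Hook.
Context (d : measure_display) (T : measurableType d) (R : realType).
Variables (P : probability T R) (N : int -> R -> T -> nat).
Variables (zeta : R -> T -> int -> int) (t : R).
Hypothesis t0 : 0 <= t.
Hypothesis measurable_zeta : forall x c, measurable [set w | zeta t w x = c].
Hypothesis clocks : poisson_clocks P N.
Hypothesis path : {ae P, forall w,
  colored_TASEP_path (fun k => rings (fun t => N k t w)) (fun t => zeta t w)}.

Definition level_count (p : int * int) (w : T) : \bar R :=
  counting [set x : int | x < p.2 /\ p.1 <= zeta t w x].

Definition counts_eq (s : seq (int * int)) (v : seq (\bar R)) : set T :=
  [set w | [seq level_count p w | p <- s] = v].

Lemma measurable_counts_eq s v : measurable (counts_eq s v).
Proof.
rewrite /counts_eq; elim: s v => [|p s IH] [|c v] /=.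
- by rewrite (_ : [set w | _] = setT)//; apply/seteqP; split.
- by rewrite (_ : [set w | _] = set0)//; apply/seteqP; split.
- by rewrite (_ : [set w | _] = set0)//; apply/seteqP; split.
rewrite (_ : [set w | _] = [set w | level_count p w = c] `&`
   [set w | [seq level_count p w | p <- s] = v]).
  apply: measurableI; last exact: IH.
  apply: measurable_counting => x.
  rewrite (_ : [set w | _] = \bigcup_(e in [set e : int | x < p.2 /\ p.1 <= e])
      [set w | zeta t w x = e]).
    rewrite bigcup_mkcond; apply: countable_bigcupT_measurable => // e.
    by case: ifP.
  apply/seteqP; split=> w /=; first by move=> ?; exists (zeta t w x).
  by move=> [e /= h ->].
by apply/seteqP; split=> w /= [-> ->].
Qed.

Let sil e w := silent N t (e, 0%N) w.

Lemma silE e w : sil e w = (N e t w == N e 0 w).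
Proof. by rewrite /sil /silent /= mulr1 mulr0. Qed.

Let q : R := 1 - expR (- t).

Lemma q01 : 0 <= q < 1.
Proof. by rewrite /q subr_ge0 -expR0 ler_expR oppr_le0 t0 gtrBl expR_gt0. Qed.

Lemma measurable_ringing (es : seq int) :
  measurable [set w | all (fun e => ~~ sil e w) es].
Proof.
apply: (@measurable_all _ _ _ _ (fun e w => ~~ sil e w)) => e.
under eq_set do rewrite -eqbF_neg; apply: measurable_eqb.
exact: (measurable_silent clocks t0).
Qed.

Lemma prob_ringing (es : seq int) : uniq es ->
  P [set w | all (fun e => ~~ sil e w) es] = (q ^+ size es)%:E.
Proof.
move=> ues; have ul : uniq [seq (e, 0%N) | e <- es].
  by rewrite map_inj_uniq// => e1 e2 [].
have := silent_independent clocks t0 xpred0 ul.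
rewrite big_map /weight /= big_const_seq count_predT iter_mulr_1 => <-.
congr (P _); apply/seteqP; split=> w /=; rewrite all_map;
  by apply: sub_all => e /=; rewrite eqbF_neg.
Qed.

Lemma pow_q_small (eps : R) : 0 < eps -> exists n, q ^+ n <= eps.
Proof.
move=> eps0; have /andP[q0 q1] := q01.
have : `|q| < 1 by rewrite ger0_norm.
move=> /cvg_expr /cvgrPdist_le /(_ eps eps0) [n _ /(_ n (leqnn n))].
by rewrite sub0r normrN ger0_norm ?exprn_ge0// => h; exists n.
Qed.

(** The first [j] edges left of a given one all ring with probability [q ^+ j], which tends to 0. *)
Lemma silent_left : {ae P, forall w, forall x : int, exists2 e, e < x & sil e w}.
Proof.
suff : {ae P, forall w, forall n : nat, exists2 e, e < - n%:Z & sil e w}.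
  apply: filterS => w h x; have [e ex se] := h (absz x).
  by exists e => //; lia.
apply: ae_foralln => n.
pose es j := [seq - n%:Z - 1 - i%:Z | i : nat <- iota 0 j].
have ues j : uniq (es j) by rewrite map_inj_uniq ?iota_uniq// => i i' /addrI/oppr_inj [].
pose B := \bigcap_j [set w | all (fun e => ~~ sil e w) (es j)].
have mB : measurable B by apply: bigcapT_measurable => j; exact: measurable_ringing.
exists B; split=> //.
  apply/eqP; rewrite eq_le measure_ge0 andbT; apply/lee_addgt0Pr => e e0.
  have [j qj] := pow_q_small e0.
  have : (P B <= P [set w | all (fun e => ~~ sil e w) (es j)])%E.
    by apply: le_probability => //; [exact: measurable_ringing|move=> w; apply].
  rewrite prob_ringing// size_map size_iota add0e => /le_trans; apply.
  by rewrite lee_fin.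
move=> w /= h j _ /=; apply/allP => e /mapP[i _ eE]; apply/negP => se.
by apply: h; exists e => //; lia.
Qed.

Lemma adjacent_small (delta : R) (e : int) (m : nat) : 0 <= delta ->
  (P [set w | ~~ silent N delta (e, m) w && ~~ silent N delta (e + 1, m)%R w]
     <= (delta ^+ 2)%:E)%E.
Proof.
move=> d0; have ul : uniq [:: (e, m); (e + 1, m)].
  rewrite /= andbT inE xpair_eqE eqxx andbT; lia.
have := silent_independent clocks d0 xpred0 ul.
rewrite !big_cons big_nil mulr1 /weight /= => E.
rewrite (_ : [set w | _] = [set w | (silent N delta (e, m) w == false) &&
  (silent N delta (e + 1, m) w == false)]).
  rewrite [X in (X <= _)%E](_ : _ = ((1 - expR (- delta)) * (1 - expR (- delta)))%:E).
    rewrite lee_fin expr2; have := expR_ge1Dx (- delta).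
    have : expR (- delta) <= 1 by rewrite -expR0 ler_expR oppr_le0.
    by move=> h1 h2; rewrite ler_pM; lra.
  by rewrite -E; congr (P _); apply/seteqP; split=> w /=; rewrite andbT.
by apply/seteqP; split=> w /=; rewrite !eqbF_neg.
Qed.

Lemma counts_hook (k y : int) (al : seq (int * int)) (ts : seq nat) v :
  all (fun p : int * int => (p.1 <= k) && (y <= p.2)) al ->
  P (counts_eq (al ++ [seq (k + i%:Z, y) | i : nat <- ts]) v) =
  P (counts_eq (al ++ [seq (k, y - i%:Z) | i : nat <- ts]) v).
Proof.
set s1 := al ++ _; set s2 := al ++ _ => al_ky.
have [n0 n0P] : exists n0 : nat, [/\ all (fun p : int * int =>
    (`|p.1| <= n0%:Z) && (`|p.2| <= n0%:Z)) (s1 ++ s2), `|k| <= n0%:Z & `|y| <= n0%:Z].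
  have [n hn] : exists n : nat, all (fun p : int * int =>
     (`|p.1| <= n%:Z) && (`|p.2| <= n%:Z)) (s1 ++ s2).
    elim: (s1 ++ s2) => [|p s [n IH]]; first by exists 0%N.
    exists (n + absz p.1 + absz p.2)%N => /=; apply/andP; split; first by lia.
    by apply: sub_all IH => r; lia.
  exists (n + absz k + absz y)%N; split; [|lia|lia].
  by apply: sub_all hn => r; lia.
have [n0s n0k n0y] := n0P.
apply: (approx_eq (measurable_counts_eq s1 v) (measurable_counts_eq s2 v)) => eps eps0.
have e30 : 0 < eps / 3 by rewrite divr_gt0.
have [n qn] := pow_q_small e30.
(* Beyond the cuts at stake, bounded by [n0], a silent edge is sought among the next [n] on each
   side; none is found with probability at most [eps / 3]. *)
pose b := (n0 + n)%N.
pose W : R := (2 * b)%N%:R.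
pose X : R := W * t ^+ 2 / (eps / 3).
have X0 : 0 <= X.
  apply: divr_ge0; last exact: ltW.
  by apply: mulr_ge0; [exact: ler0n|exact: exprn_ge0].
(* [K >= X] bounds by [eps / 3] the sum of [delta ^+ 2] over the [2 * b * K] cells, and the term
   [2 * n0] ensures [k <= y + K]. *)
pose K := (2 * n0 + Num.bound X).+1.
have XK : X <= K%:R.
  apply: (le_trans (ltW (archi_boundP X0))); rewrite ler_nat /K; lia.
have K0 : (0 : R) < K%:R by rewrite ltr0n.
pose delta := t / K%:R.
have d0 : 0 <= delta by rewrite divr_ge0// ltW.
have tE : delta * K%:R = t by rewrite /delta divfK// gt_eqF.
(* With this length, the last row still reaches the cut [b]. *)
pose c : int := - b%:Z; pose L := (K + 2 * b)%N.
pose esl := [seq - n0%:Z - 1 - i%:Z | i : nat <- iota 0 n].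
pose esr := [seq n0%:Z + i%:Z | i : nat <- iota 0 n].
pose adj (em : int * nat) w :=
  ~~ silent N delta em w && ~~ silent N delta (em.1 + 1, em.2) w.
pose ems := [seq (c + i%:Z, m) | i : nat <- iota 0 (2 * b), m <- iota 0 K].
have madj em : measurable [set w | adj em w].
  rewrite (_ : [set w | _] = ~` [set w | silent N delta em w] `&`
      ~` [set w | silent N delta (em.1 + 1, em.2) w]).
    by apply: measurableI; apply: measurableC;
      exact: (measurable_silent clocks d0).
  apply/seteqP; split=> w /=; first by move=> /andP[/negP h1 /negP h2].
  by move=> [/negP h1 /negP h2]; rewrite /adj h1.
(* The exceptional events: [B0] is null, [B1] and [B2] leave no silent edge to the left or right of
   the window, and in [B3] two adjacent edges ring in the same slot. *)
have [B0 [mB0 PB0 B0P]] := filterI path silent_left.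
pose B1 := [set w | all (fun e => ~~ sil e w) esl].
pose B2 := [set w | all (fun e => ~~ sil e w) esr].
pose B3 := [set w | has (adj^~ w) ems].
have mB1 : measurable B1 by exact: measurable_ringing.
have mB2 : measurable B2 by exact: measurable_ringing.
have mB3 : measurable B3.
  rewrite (_ : B3 = \bigcup_(em in [set` ems]) [set w | adj em w]).
    by apply: fin_bigcup_measurable => // *; exact: madj.
  apply/seteqP; split=> w /=; first by move/hasP=> [em]; exists em.
  by move=> [em h1 h2]; apply/hasP; exists em.
pose model s := [set w | [seq (exec (silent N delta) (fun i => i.1 + 1) w
   (cells c L 0 K) packed p.1 p.2)%:R%:E | p <- s] == v :> seq (\bar R)].
have mmodel s : measurable (model s).
  exact: (measurable_exec _ (measurable_silent clocks d0) _ _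
    (fun H : state => [seq (H p.1 p.2)%:R%:E | p <- s] == v :> seq (\bar R))).
have modelE s : P (model s) = (run (rows_word c K (nseq L (expR (- delta))))
    (fun G => ([seq (G p.1 p.2)%:R%:E | p <- s] == v :> seq (\bar R))%:R) packed)%:E.
  rewrite -(rows_cells _ c L 0 K).
  exact: (prob_exec (fun i => i.1 + 1) (measurable_silent clocks d0)
    (silent_independent clocks d0) packed
    (fun H : state => [seq (H p.1 p.2)%:R%:E | p <- s] == v :> seq (\bar R))
    (uniq_cells c L 0 K)).
exists (B0 `|` B1 `|` B2 `|` B3), (model s1), (model s2); split.
- by split=> //; do !apply: measurableU.
- have PB0' : (P B0 <= 0)%E by rewrite PB0.
  have PB1 : (P B1 <= (eps / 3)%:E)%E.
    rewrite /B1 prob_ringing ?size_map ?size_iota ?lee_fin//.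
    by rewrite map_inj_uniq ?iota_uniq// => i j /addrI/oppr_inj [].
  have PB2 : (P B2 <= (eps / 3)%:E)%E.
    rewrite /B2 prob_ringing ?size_map ?size_iota ?lee_fin//.
    by rewrite map_inj_uniq ?iota_uniq// => i j /addrI [].
  have PB3 : (P B3 <= (eps / 3)%:E)%E.
    apply: (le_trans (union_bound ems madj (x := delta ^+ 2) _)).
      by move=> [e m]; exact: adjacent_small.
    rewrite size_allpairs !size_iota lee_fin natrM -/W /delta.
    move: XK; rewrite /X ler_pdivrMr// => XK.
    have -> : W * K%:R * (t / K%:R) ^+ 2 = W * t ^+ 2 / K%:R.
      by field; rewrite gt_eqF.
    by rewrite ler_pdivrMr// [eps / 3 * _]mulrC.
  have -> : eps = 0 + eps / 3 + eps / 3 + eps / 3 by field.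
  rewrite !EFinD.
  apply: (le_trans (measureU2 P (measurableU _ _ (measurableU _ _ mB0 mB1) mB2) mB3)).
  apply: leeD => //.
  apply: (le_trans (measureU2 P (measurableU _ _ mB0 mB1) mB2)); apply: leeD => //.
  by apply: (le_trans (measureU2 P mB0 mB1)); apply: leeD => //; exact: PB0'.
- rewrite !modelE; congr (_%:E).
  (* [g] tests the heights of [al] against the beginning of [v], and [psi] those of the profile
     against the rest. *)
  pose g (G : state) : R :=
    ([seq (G p.1 p.2)%:R%:E | p <- al] == take (size al) v :> seq (\bar R))%:R.
  pose psi (u : nat -> nat) : R :=
    ([seq (u i)%:R%:E | i <- ts] == drop (size al) v :> seq (\bar R))%:R.
  have dg : depends k y g.
    move=> G G' GG'; rewrite /g; congr (_ == _)%:R; apply/eq_in_map => p.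
    by move=> /(allP al_ky) /andP[h1 h2]; rewrite GG'.
  have := @rows_hook R c k y K L (expR (- delta)) g psi _ _ _ dg.
  have -> : (fun G => g G * psi (profile_in k y G)) =
      (fun G => ([seq (G p.1 p.2)%:R%:E | p <- s1] == v :> seq (\bar R))%:R).
    apply/funext => G.
    by rewrite /s1 map_cat cat_eq_take_drop size_map -mulnb natrM -map_comp.
  have -> : (fun G => g G * psi (profile_out k y G)) =
      (fun G => ([seq (G p.1 p.2)%:R%:E | p <- s2] == v :> seq (\bar R))%:R).
    apply/funext => G.
    by rewrite /s2 map_cat cat_eq_take_drop size_map -mulnb natrM -map_comp.
  by apply; rewrite /c /L /K /b; lia.
move=> w Bw.
have [nB0 nB1 nB2 nB3] : [/\ ~ B0 w, ~ B1 w, ~ B2 w & ~ B3 w].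
  by split=> h; apply: Bw; [left; left; left|left; left; right|left; right|right].
have [pw lw] : colored_TASEP_path (fun k => rings (fun t => N k t w))
    (fun t => zeta t w) /\ forall x : int, exists2 e, e < x & sil e w.
  by apply: contrapT => h; apply: nB0; apply: B0P.
have [e1 e1l se1] : exists2 e, e \in esl & sil e w.
  by apply: contrapT => h; apply: nB1; apply/allP => e el; apply/negP => se;
     apply: h; exists e.
have [e2 e2r se2] : exists2 e, e \in esr & sil e w.
  by apply: contrapT => h; apply: nB2; apply/allP => e el; apply/negP => se;
     apply: h; exists e.
have [hN _] := clocks.
move: e1l e2r => /mapP[i1]; rewrite mem_iota => /andP[_ i1n] e1E.
move=> /mapP[i2]; rewrite mem_iota => /andP[_ i2n] e2E.
have nadj m : (m < K)%N -> forall e : int, e1 + 1 <= e + 1 -> e + 1 < e2 + 1 ->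
    silent N delta (e, m) w || silent N delta (e + 1, m) w.
  move=> mK e he1 he2; apply: contrapT => /negP; rewrite negb_or => h.
  apply: nB3; apply/hasP; exists (e, m) => //.
  have [ec ib] : e = c + (absz (e - c)%R)%:Z /\ (absz (e - c)%R < 2 * b)%N.
    by move: he1 he2 i1n i2n; rewrite e1E e2E /c /b !add0n; clear; lia.
  rewrite {1}ec; apply: allpairs_f; first by rewrite mem_iota add0n ib.
  by rewrite mem_iota add0n mK.
have window_l (a : int) (m j : nat) : `|a| <= m%:Z -> - m%:Z - 1 - j%:Z + 1 <= a.
  by clear; lia.
have window_r (a : int) (m j : nat) : `|a| <= m%:Z -> a <= m%:Z + j%:Z + 1.
  by clear; lia.
have count_model s : {subset s <= s1 ++ s2} ->
    [seq level_count p w | p <- s] = [seq (exec (silent N delta) (fun i => i.1 + 1) w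
      (cells c L 0 K) packed p.1 p.2)%:R%:E | p <- s].
  move=> ss; apply/eq_in_map => p /ss /(allP n0s) /andP[hp1 hp2].
  have := @counting_exec R d T N w (fun t => zeta t w) delta (e1 + 1) (e2 + 1)
    _ _ pw d0 c L K _ _ _ _ _ nadj p.1 p.2 _ _.
  rewrite tE; apply; rewrite ?addrK.
  - by move=> e r r' r0 rr'; apply: (poisson_process_nondecreasing (hN e)).
  - by move=> e t' t'0; apply: (poisson_process_right_continuous (hN e)).
  - by move: i1n; rewrite e1E /c /b add0n; clear; lia.
  - by move: i2n; rewrite e2E /c /L /b add0n; clear; lia.
  - by apply/eqP; rewrite -silE.
  - by apply/eqP; rewrite -silE.
  - by move=> x; have [e ex] := lw x; rewrite silE => /eqP se; exists e.
  - by rewrite e1E; exact: window_l hp1.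
  - by rewrite e1E e2E window_l// window_r.
by split; rewrite /counts_eq /model /= count_model; try (by split=> /eqP);
   move=> p ps; rewrite mem_cat ps ?orbT.
Qed.

End Hook.

(** * Laws carried by countable sets, and the conclusion *)

Lemma same_law_discrete d (T : measurableType d) (R : realType)
    (P : probability T R) d' (T' : measurableType d') (U : countType)
    (val : U -> T') (X Y : T -> T') :
  injective val -> (forall w, exists u, X w = val u) ->
  (forall w, exists u, Y w = val u) ->
  (forall u, measurable [set w | X w = val u]) ->
  (forall u, measurable [set w | Y w = val u]) ->
  (forall u, P [set w | X w = val u] = P [set w | Y w = val u]) ->
  same_distribution P X Y.
Proof.
move=> inj Xv Yv mX mY PXY B _; rewrite /pushforward.
pose D := [set i : nat | exists2 u : U, choice.pickle u = i & B (val u)].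
pose F (Z : T -> T') (i : nat) :=
  [set w | exists2 u : U, choice.pickle u = i & Z w = val u].
have FE Z (u : U) : F Z (choice.pickle u) = [set w | Z w = val u].
  apply/seteqP; split=> w /=.
    by move=> [u' e ->]; rewrite (pcan_inj choice.pickleK e).
  by move=> h; exists u.
have law Z : (forall w, exists u, Z w = val u) ->
    (forall u, measurable [set w | Z w = val u]) ->
    (* The preimage of [B] is cut according to the value taken, numbered by [pickle]. *)
    P (Z @^-1` B) = (\sum_(0 <= i <oo | i \in D) P (F Z i))%E.
  move=> Zv mZ; rewrite -measure_bigcup.
  - congr (P _); apply/seteqP; split=> w /=.
      move=> BZ; have [u Zu] := Zv w; exists (choice.pickle u).
        by exists u => //; rewrite -Zu.
      by exists u.
    by move=> [_ [u <- Bu]]; rewrite FE /= => ->.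
  - by move=> _ [u <- _]; rewrite FE.
  - move=> _ _ [u <- _] [u' <- _]; rewrite !FE => -[w [/= -> /inj ->]]; by [].
rewrite !law//; apply: eq_eseriesr => i; rewrite inE => -[u <- _].
by rewrite !FE.
Qed.

Definition count_value (R : realType) (u : option nat) : \bar R :=
  if u is Some n then n%:R%:E else +oo%E.

Lemma count_value_inj (R : realType) : injective (@count_value R).
Proof.
by move=> [m|] [n|] //= [] /eqP; rewrite eqr_nat => /eqP ->.
Qed.

Lemma counting_value (R : realType) (X : choiceType) (A : set X) :
  exists u, counting A = count_value R u.
Proof.
rewrite /counting; case: ifP => _; last by exists None.
by exists (Some #|` fset_set A|).
Qed.

(** The integers below [m + 1/2] are those below [m + 1], so the observation point is the cut
    [m + 1]. *)
Lemma height_half (R : realType) (z : int -> int) (i m : int) :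
  height z i (m%:~R + 2^-1 : R) = counting [set x : int | x < m + 1 /\ i <= z x].
Proof.
rewrite /height; congr counting; apply/seteqP; split=> x /= [h ?]; split=> //.
  rewrite -(ltr_int R) rmorphD /=; apply: lt_le_trans h _.
  by rewrite lerD2l; lra.
have : x <= m by lia.
rewrite -(ler_int R) => /le_lt_trans; apply.
by rewrite ltrDl invr_gt0.
Qed.

Theorem theorem2p2 (d : measure_display) (T : measurableType d) (R : realType)
    (P : probability T R) (zeta : R -> T -> int -> int)
    (hzeta : colored_TASEP P zeta)
    (n : nat) (hn : (1 <= n)%N) (a : nat) (ha : (1 <= a)%N)
    (k : 'I_n -> int) (t : R) (ht : 0 <= t)
    (y : 'I_n -> R) (hy : forall j, half_integer (y j))
    (hk_le : forall i j : 'I_n, (i <= j)%N -> k i <= k j)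
    (hk'_le : forall i j : 'I_n, (i <= j)%N -> shift_at a k i <= shift_at a k j)
    (hy_ge : forall i j : 'I_n, (i <= j)%N -> y j <= y i)
    (hy'_ge : forall i j : 'I_n, (i <= j)%N -> shift_at a y j <= shift_at a y i) :
  same_distribution P
    (fun w => [tuple height (zeta t w) (k j) (y j) | j < n])
    (fun w => [tuple height (zeta t w) (shift_at a k j) (shift_at a y j) | j < n]).
Proof.
have [mzeta [N [clocks path]]] := hzeta.
have {}mzeta x c : measurable [set w | zeta t w x = c] by apply: mzeta.
pose m j := projT1 (cid (hy j)).
have yE j : y j = (m j)%:~R + 2^-1 by exact: projT2 (cid (hy j)).
have y'E j : shift_at a y j = (shift_at a m j)%:~R + 2^-1.
  by rewrite /shift_at yE; case: eqP => _ //; rewrite rmorphD /= addrAC.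
pose chain (k0 m0 : 'I_n -> int) : seq (int * int) :=
  [seq (k0 j, m0 j + 1) | j <- enum 'I_n].
have crosses_chain (k0 m0 : 'I_n -> int) :
    (forall i j : 'I_n, (i <= j)%N -> k0 i <= k0 j) ->
    (forall i j : 'I_n, (i <= j)%N ->
       (m0 j)%:~R + 2^-1 <= (m0 i)%:~R + 2^-1 :> R) ->
    pairwise crosses (chain k0 m0).
  move=> k0le m0ge; rewrite /chain pairwise_map.
  have : pairwise leq [seq val j | j <- enum 'I_n].
    by rewrite val_enum_ord -(sorted_pairwise leq_trans) iota_sorted.
  rewrite pairwise_map; apply: sub_pairwise => i j ij.
  by rewrite /crosses /= k0le// lerD2r; have := m0ge i j ij; rewrite lerD2r ler_int.
pose prob s v := P (counts_eq zeta t s v).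
have prob_hook (k0 y0 : int) (al : seq (int * int)) (ts : seq nat) :
    all (fun p : int * int => (p.1 <= k0) && (y0 <= p.2)) al ->
    prob (al ++ [seq (k0 + i%:Z, y0) | i : nat <- ts]) =
    prob (al ++ [seq (k0, y0 - i%:Z) | i : nat <- ts]).
  by move=> al_ky; apply/funext => v; apply: (counts_hook ht mzeta clocks path).
set s1 := chain k m; set s2 := chain (shift_at a k) (shift_at a m).
(* A common corner for both chains, so that both get aligned on the same color. *)
have [k0 [y0]] : exists k0 y0 : int,
    all (fun p : int * int => (k0 <= p.1) && (p.2 <= y0)) (s1 ++ s2).
  elim: (s1 ++ s2) => [|p s [k0 [y0 IH]]]; first by exists 0, 0.
  exists (Num.min k0 p.1), (Num.max y0 p.2) => /=.
  rewrite ge_min le_max !lexx !orbT /=; apply: sub_all IH => q.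
  by rewrite ge_min le_max => /andP[-> ->].
rewrite all_cat => /andP[b1 b2].
(* The shift adds 1 to both the color and the cut of a point, so the two aligned chains are
   equal. *)
have prob_shift : prob s1 = prob s2.
  rewrite (chain_align prob_hook _ b1); last first.
    by apply: crosses_chain => // i j ij; rewrite -!yE; exact: hy_ge.
  rewrite (chain_align prob_hook _ b2); last first.
    by apply: crosses_chain => // i j ij; rewrite -!y'E; exact: hy'_ge.
  congr prob; rewrite /s1 /s2 /chain -!map_comp; apply: eq_map => j /=.
  by rewrite /align /shift_at /=; case: eqP => _ //; congr (_, _); lia.
pose X (k1 m1 : 'I_n -> int) w : n.-tuple (\bar R) :=
  [tuple counting [set x : int | x < m1 j + 1 /\ k1 j <= zeta t w x] | j < n].
have XE (k1 m1 : 'I_n -> int) (y1 : 'I_n -> R) : (forall j, y1 j = (m1 j)%:~R + 2^-1) ->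
    (fun w => [tuple height (zeta t w) (k1 j) (y1 j) | j < n]) = X k1 m1.
  move=> y1E; apply/funext => w; apply: eq_from_tnth => j.
  by rewrite !tnth_mktuple y1E height_half.
rewrite (XE k m)// (XE (shift_at a k) (shift_at a m))//.
have counts (k1 m1 : 'I_n -> int) (u : n.-tuple (option nat)) :
    [set w | X k1 m1 w = map_tuple (@count_value R) u] =
    counts_eq zeta t (chain k1 m1) (map (@count_value R) u).
  apply/seteqP; split=> w /=; rewrite /counts_eq /chain /=.
    by move=> /(congr1 val) /= <-; rewrite -map_comp.
  by move=> h; apply: val_inj; rewrite /= -h -map_comp.
have X_value (k1 m1 : 'I_n -> int) w : exists u : n.-tuple (option nat),
    X k1 m1 w = map_tuple (@count_value R) u.
  exists [tuple projT1 (cid (counting_value R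
     [set x : int | x < m1 j + 1 /\ k1 j <= zeta t w x])) | j < n].
  apply: eq_from_tnth => j; rewrite [RHS]tnth_map !tnth_mktuple.
  exact: (projT2 (cid (counting_value R _))).
apply: (@same_law_discrete _ _ _ _ _ _ _ (fun u : n.-tuple (option nat) =>
    map_tuple (@count_value R) u)).
- move=> u v /(congr1 val) /= /(inj_map (@count_value_inj R)) uv.
  exact: val_inj.
- by move=> w; exact: X_value.
- by move=> w; exact: X_value.
- by move=> u; rewrite counts; exact: measurable_counts_eq.
- by move=> u; rewrite counts; exact: measurable_counts_eq.
by move=> u; rewrite !counts -/s1 -/s2 -!/(prob _ _) prob_shift.
Qed.
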